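(* Let $\sigma_1,\sigma_2\in L_2[0,1]$ and $d>0$. If $D(x,\mu)$ is the solution of the Cauchy problem \[ D'(x)+J(x)D(x)=A_\mu D(x),\quad x\in[0,1],\qquad D(0)=I, \] then \[ D(x,\mu)=e^{xA_\mu}+D^{(0)}(x,\mu)+D^{(1)}(x,\mu), \] where \[ D^{(0)}(x,\mu)=-\int_0^x e^{(x-2t)A_\mu}J(t)\,dt+\int_0^x e^{(x-2t)A_\mu}N(x,t)\,dt, \] and for all $\mu\in P_d$, \[ \|D^{(1)}(x,\mu)\|_{M(C[0,1])}\le 2e^{5d}\exp(e^{2d}l_1)\,\gamma_2(\mu), \] where the norm is taken with respect to the variable $x\in[0,1]$.
   Context: $\sigma_1,\sigma_2$ are complex-valued functions on $[0,1]$, $P_d:=\{\mu\in\mathbb{C}:|\mathrm{Im}\,\mu|\le d\}$, and \[ J(x)=\begin{bmatrix}0&\sigma_1(x)\\ \sigma_2(x)&0\end{bmatrix},\quad J_0=\begin{bmatrix}1&0\\0&-1\end{bmatrix},\quad A_\mu=i\mu J_0,\quad I=\begin{bmatrix}1&0\\0&1\end{bmatrix}. \] Solutions have absolutely continuous entries and satisfy the equation a.e. For a Banach space $X$, $M(X)$ is the space of $2\times2$ matrices with entries in $X$ and norm $\|F\|_{M(X)}=\sum_{k,j=1}^2\|F_{kj}\|_X$; $L_p=L_p[0,1]$. Let $\Delta=\{(x,t):0\le t\le x\le1\}$. For $(x,t)\in\Delta$, \[ \tilde\sigma_1(x,t)=\int_0^{x-t}\sigma_1(t+\xi)\sigma_2(\xi)\,d\xi,\qquad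 \tilde\sigma_2(x,t)=\int_0^{x-t}\sigma_2(t+\xi)\sigma_1(\xi)\,d\xi, \] and for $f\in C(\Delta)$, $(T_{\sigma_j}f)(x,t)=\int_0^{x-t}\sigma_j(t+\xi)f(t+\xi,\xi)\,d\xi$. Then \[ N(x,t)=\begin{bmatrix}\tilde\sigma_1(x,t)&-(T_{\sigma_1}\tilde\sigma_2)(x,t)\\-(T_{\sigma_2}\tilde\sigma_1)(x,t)&\tilde\sigma_2(x,t)\end{bmatrix}. \] Further, $l_1=\|\sigma_1\|_{L_1}+\|\sigma_2\|_{L_1}$, $l_2=\|\sigma_1\|_{L_2}^2+\|\sigma_2\|_{L_2}^2$, $\sigma_0(x)=|\sigma_1(x)|+|\sigma_2(x)|$, \[ \gamma(\mu)=\sum_{j=1}^2\Big(\Big\|\int_0^xe^{-2i\mu t}\sigma_j(t)dt\Big\|_{L_2}+\Big\|\int_0^xe^{2i\mu t}\sigma_j(t)dt\Big\|_{L_2}\Big) \] ($L_2$-norms in $x\in[0,1]$), \[ \gamma_0(x,\mu)=\sum_{j=1}^2\Big(\Big|\int_0^xe^{-2i\mu t}\sigma_j(t)dt\Big|+\Big|\int_0^xe^{2i\mu t}\sigma_j(t)dt\Big|\Big), \] \[ \gamma_1(\mu)=\int_0^1\sigma_0(s)\gamma_0^2(s,\mu)\,ds,\qquad \gamma_2(\mu)=l_2\gamma^2(\mu)+l_1\gamma_1(\mu). \] *)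

(* Defs.v *)
From mathcomp Require Import all_boot all_order all_algebra complex.
From mathcomp Require Import all_classical all_reals all_analysis.

Set Implicit Arguments.
Unset Strict Implicit.
Unset Printing Implicit Defensive.

Import Order.TTheory GRing.Theory Num.Theory.
Import numFieldNormedType.Exports.

Local Open Scope classical_set_scope.
Local Open Scope complex_scope.
Local Open Scope ring_scope.

(* R[i] carries no topology or measurable structure in the libraries, so
   limits, continuity, derivatives, measurability and integrals of
   complex-valued functions of a real variable are taken on real and imaginary
   parts.  Functions on [0,1] are total functions on R whose values outside
   [0,1] are never used. *)

Definition cmod (R : realType) (z : R[i]) : R := ComplexField.Normc.normc z.

Definition cexp (R : realType) (z : R[i]) : R[i] :=
  (expR (complex.Re z) * cos (complex.Im z))
    +i* (expR (complex.Re z) * sin (complex.Im z)).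

Definition cintegral (R : realType) (a b : R) (f : R -> R[i]) : R[i] :=
  (\int[lebesgue_measure]_(t in `[a, b]) complex.Re (f t))
    +i* (\int[lebesgue_measure]_(t in `[a, b]) complex.Im (f t)).

Definition mxintegral (R : realType) (a b : R) (F : R -> 'M[R[i]]_2) :
  'M[R[i]]_2 :=
  \matrix_(k, j) cintegral a b (fun t => F t k j).

Definition Lpnorm01 (R : realType) (p : R) (f : R -> R[i]) : \bar R :=
  Lnorm lebesgue_measure p%:E
    ((fun x => (cmod (f x))%:E) \_ `[0%R, 1%R]).

Definition in_Lp01 (R : realType) (p : R) (f : R -> R[i]) : Prop :=
  [/\ measurable_fun (`[0, 1] : set R) (fun x => complex.Re (f x)),
      measurable_fun (`[0, 1] : set R) (fun x => complex.Im (f x)) &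
      (Lpnorm01 p f < +oo)%E].

Definition normL (R : realType) (p : R) (f : R -> R[i]) : R :=
  fine (Lpnorm01 p f).

Definition in_C01 (R : realType) (f : R -> R[i]) : Prop :=
  {within (`[0, 1] : set R), continuous (fun x => complex.Re (f x))} /\
  {within (`[0, 1] : set R), continuous (fun x => complex.Im (f x))}.

Definition normC01 (R : realType) (f : R -> R[i]) : \bar R :=
  ereal_sup [set (cmod (f x))%:E | x in (`[0, 1] : set R)].

Definition in_M (R : realType) (X : (R -> R[i]) -> Prop)
  (F : R -> 'M[R[i]]_2) : Prop :=
  forall k j, X (fun x => F x k j).

Definition normM (R : realType) (normX : (R -> R[i]) -> \bar R)
  (F : R -> 'M[R[i]]_2) : \bar R :=
  (\sum_(k < 2) \sum_(j < 2) normX (fun x => F x k j))%E.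

Definition abs_continuous01 (R : realType) (f : R -> R[i]) : Prop :=
  forall eps : R, 0 < eps -> exists2 delta : R, 0 < delta &
    forall (n : nat) (a b : 'I_n -> R),
      (forall i, [/\ 0 <= a i, a i < b i & b i <= 1]) ->
      trivIset [set: 'I_n] (fun i => `]a i, b i[%classic) ->
      \sum_(i < n) (b i - a i) < delta ->
      \sum_(i < n) cmod (f (b i) - f (a i)) < eps.

Definition mxderivable (R : realType) (F : R -> 'M[R[i]]_2) (x : R) : Prop :=
  forall k j, derivable (fun y => complex.Re (F y k j)) x 1 /\
              derivable (fun y => complex.Im (F y k j)) x 1.

Definition mxderive (R : realType) (F : R -> 'M[R[i]]_2) (x : R) :
  'M[R[i]]_2 :=
  \matrix_(k, j) ((derive1 (fun y => complex.Re (F y k j)) x)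
                    +i* (derive1 (fun y => complex.Im (F y k j)) x)).

Definition expmx_partial (R : realType) (A : 'M[R[i]]_2) (n : nat) :
  'M[R[i]]_2 :=
  \sum_(0 <= m < n) (m`!%:R^-1 : R[i]) *: A ^+ m.

Definition expmx (R : realType) (A : 'M[R[i]]_2) : 'M[R[i]]_2 :=
  \matrix_(k, j)
    ((lim ((fun n => complex.Re (expmx_partial A n k j)) @ \oo) : R)
      +i* (lim ((fun n => complex.Im (expmx_partial A n k j)) @ \oo) : R)).

Definition mx22 (R : realType) (a b c d : R[i]) : 'M[R[i]]_2 :=
  \matrix_(k < 2, j < 2)
    if k == 0 then (if j == 0 then a else b) else (if j == 0 then c else d).

Definition Jmx (R : realType) (sigma1 sigma2 : R -> R[i]) (x : R) :
  'M[R[i]]_2 :=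
  mx22 0 (sigma1 x) (sigma2 x) 0.

Definition J0 (R : realType) : 'M[R[i]]_2 := mx22 1 0 0 (-1).

Definition Amx (R : realType) (mu : R[i]) : 'M[R[i]]_2 :=
  ('i%C * mu) *: J0 R.

Definition is_cauchy_solution (R : realType) (sigma1 sigma2 : R -> R[i])
  (mu : R[i]) (D : R -> 'M[R[i]]_2) : Prop :=
  [/\ in_M (@abs_continuous01 R) D,
      {ae lebesgue_measure, forall x : R, 0 <= x <= 1 ->
         mxderivable D x /\
         mxderive D x + Jmx sigma1 sigma2 x *m D x = Amx mu *m D x} &
      D 0 = 1%:M].

(* [tsigma sigma1 sigma2] is the first iterated kernel and
   [tsigma sigma2 sigma1] the second. *)
Definition tsigma (R : realType) (s s' : R -> R[i]) (x t : R) : R[i] :=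
  cintegral 0 (x - t) (fun xi => s (t + xi) * s' xi).

Definition Top (R : realType) (s : R -> R[i]) (f : R -> R -> R[i]) (x t : R) :
  R[i] :=
  cintegral 0 (x - t) (fun xi => s (t + xi) * f (t + xi) xi).

Definition Nmx (R : realType) (sigma1 sigma2 : R -> R[i]) (x t : R) :
  'M[R[i]]_2 :=
  mx22 (tsigma sigma1 sigma2 x t) (- Top sigma1 (tsigma sigma2 sigma1) x t)
       (- Top sigma2 (tsigma sigma1 sigma2) x t) (tsigma sigma2 sigma1 x t).

Definition D0mx (R : realType) (sigma1 sigma2 : R -> R[i]) (x : R)
  (mu : R[i]) : 'M[R[i]]_2 :=
  - mxintegral 0 x
      (fun t => expmx ((x - 2 * t)%:C *: Amx mu) *m Jmx sigma1 sigma2 t)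
  + mxintegral 0 x
      (fun t => expmx ((x - 2 * t)%:C *: Amx mu) *m Nmx sigma1 sigma2 x t).

Definition l1 (R : realType) (sigma1 sigma2 : R -> R[i]) : R :=
  normL 1 sigma1 + normL 1 sigma2.

Definition l2 (R : realType) (sigma1 sigma2 : R -> R[i]) : R :=
  normL 2 sigma1 ^+ 2 + normL 2 sigma2 ^+ 2.

Definition sigma0 (R : realType) (sigma1 sigma2 : R -> R[i]) (x : R) : R :=
  cmod (sigma1 x) + cmod (sigma2 x).

Definition osc_minus (R : realType) (s : R -> R[i]) (mu : R[i]) (x : R) :
  R[i] :=
  cintegral 0 x (fun t => cexp (- 2 * 'i%C * mu * t%:C) * s t).

Definition osc_plus (R : realType) (s : R -> R[i]) (mu : R[i]) (x : R) :
  R[i] :=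
  cintegral 0 x (fun t => cexp (2 * 'i%C * mu * t%:C) * s t).

Definition gamma (R : realType) (sigma1 sigma2 : R -> R[i]) (mu : R[i]) : R :=
  \sum_(s <- [:: sigma1; sigma2])
    (normL 2 (osc_minus s mu) + normL 2 (osc_plus s mu)).

Definition gamma0 (R : realType) (sigma1 sigma2 : R -> R[i]) (x : R)
  (mu : R[i]) : R :=
  \sum_(s <- [:: sigma1; sigma2])
    (cmod (osc_minus s mu x) + cmod (osc_plus s mu x)).

Definition gamma1 (R : realType) (sigma1 sigma2 : R -> R[i]) (mu : R[i]) : R :=
  \int[lebesgue_measure]_(s in `[0, 1])
    (sigma0 sigma1 sigma2 s * gamma0 sigma1 sigma2 s mu ^+ 2).

Definition gamma2 (R : realType) (sigma1 sigma2 : R -> R[i]) (mu : R[i]) : R :=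
  l2 sigma1 sigma2 * gamma sigma1 sigma2 mu ^+ 2
  + l1 sigma1 sigma2 * gamma1 sigma1 sigma2 mu.

Definition strip (R : realType) (d : R) : set R[i] :=
  [set mu | `|complex.Im mu| <= d].

(* Main.v *)
Require Import Defs.
From mathcomp Require Import all_boot all_order all_algebra complex.
From mathcomp Require Import all_classical all_reals all_analysis.
From mathcomp Require Import measurable_realfun charge.
From mathcomp Require Import ring lra.

Set Implicit Arguments.
Unset Strict Implicit.
Unset Printing Implicit Defensive.

Import Order.TTheory GRing.Theory Num.Theory.
Import numFieldNormedType.Exports.

Local Open Scope classical_set_scope.
Local Open Scope complex_scope.
Local Open Scope ring_scope.

(** Write [A = A_mu] and [D = exp (x A) V].  Since [J] is off-diagonal it
    anticommutes with [A], and the Cauchy problem becomes [V' = - Q V], [V 0 = 1],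
    where [Q] is off-diagonal with entries [q1 = exp (- 2 i mu t) sigma1] and
    [q2 = exp (2 i mu t) sigma2].  So [V] is the alternating series of the iterated
    integrals of [Q].  After the change of variable [(t, xi) -> (t + xi, xi)] in
    the double and triple integrals ([cintegral_shear], [integral_tsigma],
    [integral_Top_tsigma]) the terms of order 1, 2 and 3 of this series are exactly
    the two integrals that make up [D0mx].

    What is left, [D1], is [exp (x A)] times the remainder of order 4, which solves
    the same integral equation with the fourth iterated integral as forcing term.
    In the first column put [b = int q2] and [c = int q1 b].  Integrating by parts
    twice turns the fourth iterated integral into
    [c ^ 2 / 2 - int q1 (int q1 b ^ 2)] ([column_remainder]), which is quadratic in
    the oscillating integral [b]: by the Cauchy-Schwarz inequality the first term is
    of size [l2 gamma ^ 2], and the second one is of size [l1 gamma1]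
    ([forcing_bound]).  Gronwall's inequality with an integrable kernel
    ([gronwall]) then gives the factor [exp (e ^ (2 d) l1)].  The second column is
    the first one for the coefficients [sigma2], [sigma1] and the parameter [- mu].

    Solutions are only absolutely continuous.  All the calculus goes through the
    predicate [cprim f g], which says that [f] is on [0,1] the indefinite integral
    of the integrable function [g]; it is stable under products ([cprimM]), which is
    integration by parts.  The fundamental theorem of calculus behind it
    ([rprimP]) rests on the fact that an absolutely continuous function whose
    derivative vanishes almost everywhere is constant ([rabs_continuous_cst]). *)

(** * Absolutely continuous real functions on [0,1] *)

(** Absolute continuity on [0,1] of a real-valued function. *)
Definition rabs_continuous01 (R : realType) (f : R -> R) : Prop :=
  forall eps : R, 0 < eps -> exists2 delta : R, 0 < delta &
    forall (n : nat) (a b : 'I_n -> R),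
      (forall i, [/\ 0 <= a i, a i < b i & b i <= 1]) ->
      trivIset [set: 'I_n] (fun i => `]a i, b i[%classic) ->
      \sum_(i < n) (b i - a i) < delta ->
      \sum_(i < n) `|f (b i) - f (a i)| < eps.

Section ac_real.
Variable R : realType.
Notation mu := (@lebesgue_measure R).
Implicit Types (f g : R -> R).

Let aeS (P Q : R -> Prop) :
  {ae mu, forall x, P x} -> (forall x, P x -> Q x) -> {ae mu, forall x, Q x}.
Proof.
move=> aP PQ; have F : Filter (almost_everywhere mu).
  exact: (ae_filter_ringOfSetsType mu).
exact: (@filterS _ _ F _ _ PQ).
Qed.

Let aeS2 (P Q S : R -> Prop) : {ae mu, forall x, P x} -> {ae mu, forall x, Q x} ->
  (forall x, P x -> Q x -> S x) -> {ae mu, forall x, S x}.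
Proof.
move=> aP aQ PQS; have F : Filter (almost_everywhere mu).
  exact: (ae_filter_ringOfSetsType mu).
by apply: (@filterS2 _ _ F _ _ _ PQS).
Qed.

Lemma derive1D_at f g (x : R) : derivable f x 1 -> derivable g x 1 ->
  derivable (fun y => f y + g y) x 1 /\
  derive1 (fun y => f y + g y) x = derive1 f x + derive1 g x.
Proof.
move=> df dg; split; first exact: (@derivableD R R R f g x 1 df dg).
by rewrite !derive1E; exact: (@deriveD R R R f g x 1 df dg).
Qed.

Lemma derive1B_at f g (x : R) : derivable f x 1 -> derivable g x 1 ->
  derivable (fun y => f y - g y) x 1 /\
  derive1 (fun y => f y - g y) x = derive1 f x - derive1 g x.
Proof.
move=> df dg; split; first exact: (@derivableB R R R f g x 1 df dg).
by rewrite !derive1E; exact: (@deriveB R R R f g x 1 df dg).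
Qed.

Lemma derive1M_at f g (x : R) : derivable f x 1 -> derivable g x 1 ->
  derivable (fun y => f y * g y) x 1 /\
  derive1 (fun y => f y * g y) x = derive1 f x * g x + f x * derive1 g x.
Proof.
move=> df dg; split; first exact: (@derivableM R R f g x 1 df dg).
rewrite !derive1E; apply: (etrans (@deriveM R R f g x 1 df dg)).
by rewrite addrC [_ *: _]mulrC.
Qed.

Lemma negligible_open_cover (N : set R) (e : R) : mu.-negligible N -> 0 < e ->
  exists U, [/\ open U, N `<=` U & (mu U < e%:E)%E].
Proof.
move=> N0 e0; have e20 : 0 < e / 2 by rewrite divr_gt0.
have [U [oU NU mU]] := @outer_measure_open_le R N _ e20.
exists U; split => //; apply: (le_lt_trans mU).
have /negligible_outer_measure -> := N0.
by rewrite add0e lte_fin ltr_pdivrMr// ltr_pMr// ltrDl.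
Qed.

Lemma derive0_increment_le f (x e : R) : derivable f x 1 -> derive1 f x = 0 -> 0 < e ->
  exists2 r : R, 0 < r & forall y, `|y - x| < r -> `|f y - f x| <= e * `|y - x|.
Proof.
move=> df f0 e0.
have : h^-1 *: (f (h + x) - f x) @[h --> 0^'] --> (0 : R).
  have /cvg_ex[l Hl] := df.
  have E : (fun h => h^-1 *: (f (h + x) - f x)) =
           (fun h => h^-1 *: (f (h *: 1 + x) - f x)).
    by apply/funext => h; rewrite [h *: 1]mulr1.
  rewrite E; rewrite -{2}f0.
  by rewrite derive1E; exact: df.
move/cvgrPdist_lt => /(_ _ e0).
move=> [r /= r0 H]; exists r => // y yx.
have [->|yx0] := eqVneq y x; first by rewrite !subrr normr0 mulr0.
have /= := H (y - x); rewrite sub0r normrN subr_eq0 => /(_ yx yx0).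
rewrite subrK sub0r normrN -[X in `|X|]/((y - x)^-1 * (f y - f x)) normrM normfV => /ltW.
by rewrite ler_pdivrMl ?normr_gt0 ?subr_eq0// mulrC.
Qed.

Lemma sum_itv_le_measure (n : nat) (a b : 'I_n -> R) (O : set R) :
  open O -> (forall i, a i < b i) ->
  (forall i, `]a i, b i[ `<=` O) ->
  trivIset [set: 'I_n] (fun i => `]a i, b i[%classic) ->
  ((\sum_(i < n) (b i - a i))%:E <= mu O)%E.
Proof.
move=> oO ab abO tI.
rewrite -sumEFin.
under eq_bigr => i _.
  have -> : (b i - a i)%:E = mu `]a i, b i[.
    by rewrite lebesgue_measure_itv/= lte_fin ab EFinB.
  over.
rewrite -(@measure_bigsetU_ord _ _ _ mu n predT (fun i => `]a i, b i[%classic))//; apply: le_measure; rewrite ?inE.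
- exact: bigsetU_measurable.
- exact: open_measurable.
- by apply: (big_ind (fun A : set R => A `<=` O)) => // A B AO BO x [/AO|/BO].
Qed.

(** The subdivision of [0,x] behind the zero-derivative theorem: away from
    finitely many disjoint intervals lying in the small open set [O], the
    increments of [f] are at most [e] times the length. *)
Definition increment_cover f (O : set R) (e x : R) : Prop :=
  exists (n : nat) (a b : nat -> R),
    [/\ (forall i, (i < n)%N -> [/\ 0 <= a i, a i < b i & b i <= x]),
        (forall i, (i < n)%N -> `]a i, b i[ `<=` O),
        (forall i j, (i < j < n)%N -> b i <= a j) &
        `|f x - f 0| <= e * x + \sum_(0 <= i < n) `|f (b i) - f (a i)|].

Lemma increment_cover_in_open f O (e u v : R) : 0 < e -> 0 <= u -> u <= v ->
  `]u, v[ `<=` O -> increment_cover f O e u -> increment_cover f O e v.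
Proof.
move=> e0 u0; rewrite le_eqVlt => /orP[/eqP <- //|uv] uvO [n [a [b [H1 H2 H3 H4]]]].
exists n.+1, (fun i => if (i < n)%N then a i else u), (fun i => if (i < n)%N then b i else v).
split.
- move=> i; rewrite ltnS; case: ltnP => [ni _|? ?]; last by split.
  by have [? ? bu] := H1 _ ni; split => //; apply: (le_trans bu); exact: ltW.
- by move=> i; rewrite ltnS; case: ltnP => [/H2|].
- move=> i j /andP[ij]; rewrite ltnS => jn.
  have iltn : (i < n)%N by apply: leq_trans ij _.
  rewrite iltn; case: ltnP => jn'; first by apply: H3; rewrite ij.
  by have [] := H1 _ iltn.
- rewrite big_nat_recr//= ltnn.
  rewrite (eq_big_nat _ _ (F2 := fun i => `|f (b i) - f (a i)|)); last first.
    by move=> i /andP[_ ->].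
  have -> : f v - f 0 = (f u - f 0) + (f v - f u) by lra.
  rewrite (le_trans (ler_normD _ _))// addrA lerD2r (le_trans H4)// lerD2r.
  by rewrite ler_wpM2l// ltW.
Qed.

Lemma increment_cover_small_slope f O (e u v : R) : 0 < e -> 0 <= u -> u <= v ->
  `|f v - f u| <= e * (v - u) -> increment_cover f O e u -> increment_cover f O e v.
Proof.
move=> e0 u0 uv fuv [n [a [b [H1 H2 H3 H4]]]].
exists n, a, b; split => //.
  by move=> i /H1[? ? bu]; split => //; exact: le_trans bu uv.
have -> : f v - f 0 = (f u - f 0) + (f v - f u) by lra.
by rewrite (le_trans (ler_normD _ _))//; lra.
Qed.

Lemma increment_cover_le f O (e d x : R) :
  0 < d -> 0 < e -> 0 <= x <= 1 -> open O -> (mu O < d%:E)%E ->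
  (forall (n : nat) (a b : 'I_n -> R),
      (forall i, [/\ 0 <= a i, a i < b i & b i <= 1]) ->
      trivIset [set: 'I_n] (fun i => `]a i, b i[%classic) ->
      \sum_(i < n) (b i - a i) < d ->
      \sum_(i < n) `|f (b i) - f (a i)| < e) ->
  increment_cover f O e x -> `|f x - f 0| <= e + e.
Proof.
move=> d0 e0 /andP[x0 x1] oO mO Hd [n [a [b [H1 H2 H3 H4]]]].
have tI : trivIset [set: 'I_n] (fun i : 'I_n => `]a i, b i[%classic).
  apply/trivIsetP => i j _ _ ij.
  wlog ij' : i j ij / (i < j)%N.
    move=> H; have [?|?|/val_inj ji] := ltngtP i j; first exact: H.
    - by rewrite setIC; apply: H => //; rewrite eq_sym.
    - by rewrite ji eqxx in ij.
  apply/seteqP; split => // z [] /=; rewrite !in_itv/= => /andP[_ z1] /andP[z2 _].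
  have := H3 i j; rewrite ij' ltn_ord => /(_ erefl) => ba; lra.
apply: (le_trans H4); apply: lerD; first by rewrite ler_piMr// ltW.
rewrite big_mkord ltW//; apply: Hd => [i||].
- by have [? ? ?] := H1 _ (ltn_ord i); split => //; exact: le_trans x1.
- exact: tI.
- rewrite -lte_fin; apply: le_lt_trans mO; apply: sum_itv_le_measure => //.
  + by move=> i; have [] := H1 _ (ltn_ord i).
  + by move=> i; exact: H2.
Qed.

(** Induction along the interval [0,1]. *)
Lemma real_induction (P : R -> Prop) :
  P 0 ->
  (forall c, 0 <= c <= 1 -> exists2 r : R, 0 < r & forall u v,
    0 <= u -> v <= 1 -> c - r < u <= c -> c <= v < c + r -> P u -> P v) ->
  forall x, 0 <= x <= 1 -> P x.
Proof.
move=> P0 step x /andP[x0 x1].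
pose S := [set y | 0 <= y <= x /\ P y].
have S0 : S 0 by split => //; rewrite lexx.
have supS : has_sup S.
  by split; [exists 0|exists x => y [/andP[]]].
set c := sup S.
have c0 : 0 <= c by apply: ub_le_sup => //; case: supS.
have cx : c <= x by apply: ge_sup => [|y [/andP[]]//]; exists 0.
have [|r r0 Hr] := step c; first by rewrite c0 (le_trans cx).
have [u [/andP[u0 ux] Pu] cu] := sup_adherent r0 supS.
have uc : u <= c by apply: ub_le_sup; [case: supS|split=> //; rewrite u0].
have Pv v : c <= v < c + r -> v <= x -> P v.
  by move=> cv vx; apply: (Hr u) => //; [exact: le_trans x1|rewrite cu].
have [->|cx'] := eqVneq x c; first by apply: Pv => //; rewrite lexx ltrDl.
have cltx : c < x by rewrite lt_neqAle eq_sym cx'.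
pose v := Num.min x (c + r / 2).
have vx : v <= x by rewrite ge_min lexx.
have cv : c < v by rewrite lt_min cltx ltrDl divr_gt0.
have vc : v < c + r by rewrite gt_min ltrD2l ltr_pdivrMr// ltr_pMr// ltrDl ltr01 orbT.
have : v <= c.
  apply: ub_le_sup; first by case: supS.
  by split; [rewrite (le_trans c0 (ltW cv)) vx|apply: Pv => //; rewrite (ltW cv)].
by rewrite leNgt cv.
Qed.

(** An absolutely continuous function whose derivative vanishes almost
    everywhere is constant.  Points with zero derivative contribute small
    increments, the others lie in an open set of small measure, where absolute
    continuity bounds the increments; real induction glues the two. *)
Lemma rabs_continuous_cst f : rabs_continuous01 f ->
  {ae mu, forall x, 0 < x < 1 -> derivable f x 1 /\ derive1 f x = 0} ->
  forall x, 0 <= x <= 1 -> f x = f 0.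
Proof.
move=> acf aef x x01; apply/eqP; rewrite -subr_eq0 -normr_le0.
apply/ler_addgt0Pl => e' e'0; rewrite addr0.
have e0 : 0 < e' / 2 by rewrite divr_gt0.
set e := e' / 2 in e0.
have [d d0 Hd] := acf _ e0.
(* The exceptional set, with the end points added so that every point outside
   it is interior. *)
pose N := (~` [set x | 0 < x < 1 -> derivable f x 1 /\ derive1 f x = 0]) `|` ([set 0; 1] : set R).
have N0 : mu.-negligible N.
  apply: negligibleU; first exact: aef.
  by apply: negligibleU; [exists [set 0]|exists [set 1]]; split => //;
    exact: lebesgue_measure_set1.
have [U [oU NU mU]] := negligible_open_cover N0 d0.
have -> : e' = e + e by rewrite -splitr.
apply: (@increment_cover_le f U e d x) => //.
apply: (@real_induction (increment_cover f U e)) x01.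
  exists 0%N, (fun=> 0), (fun=> 0); split=> //.
  by rewrite subrr normr0 big_nil mulr0 addr0.
move=> c /andP[c0 c1].
have [Uc|Uc] := pselect (U c).
  have /nbhs_ballP[r /= r0 Hr] : nbhs c U by apply: open_nbhs_nbhs.
  exists r => // u v u0 v1 /andP[cu uc] /andP[cv vc].
  apply: increment_cover_in_open => //; first exact: le_trans cv.
  move=> z /=; rewrite in_itv/= => /andP[uz zv]; apply: Hr.
  by rewrite /ball/= ltr_norml; lra.
have [c0' c1'] : 0 < c /\ c < 1.
  split; rewrite lt_neqAle ?c0 ?c1 andbT; apply/eqP => cc; apply: Uc;
    apply: NU; right; [left|right]; by rewrite cc.
have [df df0] : derivable f c 1 /\ derive1 f c = 0.
  apply: contrapT => H; apply: Uc; apply: NU; left => /= H'; apply: H.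
  by apply: H'; rewrite c0'.
have [r r0 Hr] := derive0_increment_le df df0 e0.
exists r => // u v u0 v1 /andP[cu uc] /andP[cv vc].
apply: increment_cover_small_slope => //; first exact: le_trans cv.
have -> : f v - f u = (f v - f c) - (f u - f c) by lra.
rewrite (le_trans (ler_normB _ _))//.
have := Hr v; have := Hr u.
rewrite [`|u - c|]ler0_norm ?subr_le0// [`|v - c|]ger0_norm ?subr_ge0//.
move=> H1 H2; have {}H1 := H1 ltac:(lra); have {}H2 := H2 ltac:(lra); lra.
Qed.

Lemma rabs_continuousW f g : rabs_continuous01 f ->
  (forall x, 0 <= x <= 1 -> f x = g x) -> rabs_continuous01 g.
Proof.
move=> acf fg e e0; have [d d0 H] := acf _ e0; exists d => // n a b ab tI abd.
rewrite (eq_bigr (fun i => `|f (b i) - f (a i)|)); first exact: H.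
by move=> i _; have [? ? ?] := ab i; rewrite !fg//; lra.
Qed.

(** A bound of increments by finitely many absolutely continuous ones. *)
Lemma rabs_continuous_dom f (g h : R -> R) (C : R) : 0 < C ->
  rabs_continuous01 g -> rabs_continuous01 h ->
  (forall x y, 0 <= x <= 1 -> 0 <= y <= 1 ->
     `|f y - f x| <= C * (`|g y - g x| + `|h y - h x|)) ->
  rabs_continuous01 f.
Proof.
move=> C0 acg ach fgh e e0.
have e'0 : 0 < e / (2 * C) by rewrite divr_gt0// mulr_gt0.
have [d d0 H] := acg _ e'0; have [d' d'0 H'] := ach _ e'0.
exists (Num.min d d'); first by rewrite lt_min d0.
move=> n a b ab tI; rewrite lt_min => /andP[abd abd'].
have {H} := H n a b ab tI abd; have {H'} := H' n a b ab tI abd' => H2 H1.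
apply: (@le_lt_trans _ _ (\sum_(i < n) C * (`|g (b i) - g (a i)| + `|h (b i) - h (a i)|))).
  by apply: ler_sum => i _; have [? ? ?] := ab i; apply: fgh; lra.
rewrite -mulr_sumr big_split/= (@lt_le_trans _ _ (C * (e / (2 * C) + e / (2 * C))))//.
  by rewrite ltr_pM2l// ltrD.
by rewrite le_eqVlt; apply/orP; left; apply/eqP; field; lra.
Qed.

Lemma rabs_continuous_lip f (C : R) : 0 < C ->
  (forall x y, 0 <= x <= 1 -> 0 <= y <= 1 -> `|f y - f x| <= C * `|y - x|) ->
  rabs_continuous01 f.
Proof.
move=> C0 fC e e0; exists (e / C); first by rewrite divr_gt0.
move=> n a b ab tI abC.
apply: (@le_lt_trans _ _ (\sum_(i < n) C * (b i - a i))).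
  apply: ler_sum => i _; have [? ? ?] := ab i.
  rewrite -[b i - a i]ger0_norm; last by rewrite subr_ge0 ltW.
  by apply: fC; lra.
by rewrite -mulr_sumr mulrC -ltr_pdivlMr.
Qed.

Lemma rabs_continuous_cont f : rabs_continuous01 f ->
  {within `[0, 1], continuous f}.
Proof.
move=> acf; apply/subspace_continuousP => x /=; rewrite in_itv/= => x01.
apply/cvgrPdist_lt => e e0; have [d d0 H] := acf _ e0.
near=> y.
have y01 : 0 <= y <= 1.
  by have : `[0,1]%classic y by near: y; exact: withinT; rewrite /= in_itv.
have yx : `|x - y| < d.
  by near: y; apply: cvg_within; near=> z; near: z; exact: (@cvgr_dist_lt _ _ _ _ _ (fun y : R => y)).
have P u v : 0 <= u <= 1 -> 0 <= v <= 1 -> u < v -> `|v - u| < d -> `|f v - f u| < e.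
  move=> u01 v01 uv; rewrite gtr0_norm ?subr_gt0// => uvd.
  have := H 1%N (fun=> u) (fun=> v); rewrite !big_ord1; apply => //.
    by move=> _; split => //; [case/andP: u01|case/andP: v01].
  by apply/trivIsetP => i j _ _; rewrite !ord1 eqxx.
have [xy|xy|->] := ltgtP x y; last by rewrite subrr normr0.
- by rewrite distrC; apply: P => //; rewrite distrC.
- exact: P.
Unshelve. all: by end_near. Qed.

Lemma within_continuous_bounded f : {within `[0, 1], continuous f} ->
  exists2 C : R, 0 < C & forall x, 0 <= x <= 1 -> `|f x| <= C.
Proof.
move=> cf.
have [c c01 cM] := @EVT_max R (fun x => `|f x|) 0 1 ler01
  (fun x => continuous_comp (cf x) (@norm_continuous _ _ _)).
exists (`|f c| + 1); first by rewrite ltr_wpDl.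
by move=> x x01; rewrite (le_trans (cM x _)) ?lerDl.
Qed.

Lemma rabs_continuousM f g : rabs_continuous01 f -> rabs_continuous01 g ->
  rabs_continuous01 (fun x => f x * g x).
Proof.
move=> acf acg.
have [Cf Cf0 Hf] := within_continuous_bounded (rabs_continuous_cont acf).
have [Cg Cg0 Hg] := within_continuous_bounded (rabs_continuous_cont acg).
apply: (@rabs_continuous_dom _ f g (Cf + Cg)) => //; first exact: addr_gt0.
move=> x y x01 y01.
have -> : f y * g y - f x * g x = (f y - f x) * g y + f x * (g y - g x) by ring.
rewrite (le_trans (ler_normD _ _))// !normrM.
have := Hg _ y01; have := Hf _ x01.
have := normr_ge0 (f y - f x); have := normr_ge0 (g y - g x).
have := normr_ge0 (f x); have := normr_ge0 (g y).
by nra.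
Qed.

Lemma rabs_continuousD f g : rabs_continuous01 f -> rabs_continuous01 g ->
  rabs_continuous01 (fun x => f x + g x).
Proof.
move=> acf acg; apply: (@rabs_continuous_dom _ f g 1) => // x y _ _.
rewrite mul1r; have -> : f y + g y - (f x + g x) = (f y - f x) + (g y - g x) by ring.
exact: ler_normD.
Qed.

Lemma rabs_continuousN f : rabs_continuous01 f -> rabs_continuous01 (fun x => - f x).
Proof.
move=> acf; apply: (@rabs_continuous_dom _ f f 1) => // x y _ _.
by rewrite mul1r -opprD normrN lerDl.
Qed.

(** Integrability on [0,1] of a real-valued function. *)
Definition rint01 f : Prop := mu.-integrable `[0, 1] (EFin \o f).

Lemma rint01_sub f (x y : R) : rint01 f -> 0 <= x -> y <= 1 ->
  mu.-integrable `[x, y] (EFin \o f).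
Proof.
move=> If x0 y1; apply: integrableS If => //.
by apply: subset_itv; rewrite bnd_simp.
Qed.

Lemma Rintegral_itv_split f (x y : R) : rint01 f -> 0 <= x -> x <= y -> y <= 1 ->
  \int[mu]_(t in `[0, y]) f t - \int[mu]_(t in `[0, x]) f t =
  \int[mu]_(t in `]x, y]) f t.
Proof.
move=> If x0 xy y1; apply: Rintegral_itvB => //.
exact: rint01_sub.
Qed.

(** Absolute continuity of the Lebesgue integral in its upper bound. *)
Lemma rabs_continuous_Rintegral f : rint01 f ->
  rabs_continuous01 (fun x => \int[mu]_(t in `[0, x]) f t).
Proof.
move=> If e e0.
have If' : mu.-integrable setT (EFin \o (f \_ `[0, 1])).
  by move: If; rewrite /rint01 integrable_mkcond// restrict_EFin.
have [d [d0 H]] := integral_normr_continuous If' e0.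
exists d => // n a b ab tI abd.
pose F (i : 'I_n) := `]a i, b i[%classic.
pose A := \big[setU/set0]_(i < n) F i.
have mA : measurable A by apply: bigsetU_measurable => i _; exact: measurable_itv.
have If'' B : measurable B -> mu.-integrable B (EFin \o (f \_ `[0, 1])).
  by move=> mB; apply: integrableS If'.
apply: (@le_lt_trans _ _ (\int[mu]_(x in A) `|(f \_ `[0, 1]) x|)); last first.
  apply: H => //; apply: (@le_lt_trans _ _ (\sum_(i < n) (b i - a i))%:E) => //.
  rewrite (@measure_bigsetU_ord _ _ _ mu n predT F)//; last first.
    by move=> i; exact: measurable_itv.
  have muF i : mu (F i) = (b i - a i)%:E.
    rewrite [F i]/(`]a i, b i[%classic) lebesgue_measure_itv/= lte_fin.
    by have [_ -> _] := ab i; rewrite EFinB.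
  by rewrite -sumEFin; apply: lee_sum => i _; rewrite -muF.
rewrite -lee_fin.
have -> : (\int[mu]_(x in A) `|(f \_ `[0, 1]) x|)%:E =
    (\int[mu]_(x in A) `|(f \_ `[0, 1]) x|%:E)%E.
  by rewrite fineK// integrable_fin_num//; exact: integrable_norm (If'' _ mA).
rewrite (@ge0_integral_bigsetU _ _ _ mu)//=; last 4 first.
- by move=> i; exact: measurable_itv.
- exact: index_enum_uniq.
- by apply: sub_trivIset tI.
- by apply/measurable_EFinP; have /integrable_norm/integrableP[/measurable_EFinP] := If'' _ mA.
rewrite -sumEFin; apply: lee_sum => i _.
have [a0 aib b1] := ab i.
rewrite Rintegral_itv_split//; last exact: ltW.
have Fi1 : F i `<=` `[0, 1].
  by move=> z /=; rewrite /F/= !in_itv/= => /andP[? ?]; lra.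
have -> : \int[mu]_(t in `]a i, b i]) f t = \int[mu]_(t in F i) (f \_ `[0, 1]) t.
  rewrite -Rintegral_itv_bndo_bndc; last first.
    by apply: integrableS If => // z /=; rewrite !in_itv/=; lra.
  apply: eq_Rintegral => z; rewrite inE => /Fi1 z1.
  by rewrite patchE mem_set.
have IFi : mu.-integrable (F i) (EFin \o (f \_ `[0, 1])).
  by apply: If''; exact: measurable_itv.
have := @le_normr_Rintegral _ _ R mu (F i) _ (measurable_itv _) IFi.
rewrite -lee_fin => /le_trans; apply.
rewrite fineK//; apply: integrable_fin_num; first exact: measurable_itv.
exact: integrable_norm IFi.
Qed.

(** Lebesgue's differentiation theorem on [0,1]. *)
Lemma derive_Rintegral f : rint01 f ->
  {ae mu, forall x, 0 < x < 1 ->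
    derivable (fun x : R => \int[mu]_(t in `[0, x]) f t) x 1 /\
    derive1 (fun x : R => \int[mu]_(t in `[0, x]) f t) x = f x}.
Proof.
move=> If.
have If' : mu.-integrable setT (EFin \o (f \_ `[0, 1])).
  by move: If; rewrite /rint01 integrable_mkcond// restrict_EFin.
have /lebesgue_differentiation aeL : locally_integrable setT (f \_ `[0,1]).
  exact: integrable_locally.
apply: aeS aeL _ => x Lx /andP[x0 x1].
pose F (y : R) := \int[mu]_(t in `[0, y]) (f \_ `[0, 1]) t.
have [dF F'] : derivable F x 1 /\ derive1 F x = (f \_ `[0, 1]) x.
  apply: (@FTC1_lebesgue_pt _ _ (BLeft 0) x 1) => //.
  by apply: integrableS If'.
have FE : \forall y \near x, F y = \int[mu]_(t in `[0, y]) f t.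
  near=> y; apply: eq_Rintegral => t; rewrite inE/= in_itv/= => /andP[t0 ty].
  rewrite patchE mem_set//= in_itv/= t0/= (le_trans ty)// ltW//.
  by near: y; exact: lt_nbhsl.
rewrite patchE mem_set in F'; last by rewrite /= in_itv/= !ltW.
split.
  by apply: near_eq_derivable dF.
by rewrite -F' !derive1E; apply: near_eq_derive => //; near=> y; apply/esym; near: y.
Unshelve. all: by end_near. Qed.

(** [rprim f g]: on [0,1], [f] is the primitive of the integrable [g]. *)
Definition rprim f g : Prop := rint01 g /\
  forall x, 0 <= x <= 1 -> f x = f 0 + \int[mu]_(t in `[0, x]) g t.

Lemma rprim_ac f g : rprim f g -> rabs_continuous01 f.
Proof.
move=> [Ig fE]; apply: (@rabs_continuousW (fun x => f 0 + \int[mu]_(t in `[0, x]) g t)).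
  apply: rabs_continuousD (rabs_continuous_Rintegral Ig).
  by apply: (@rabs_continuous_lip _ 1) => // x y _ _; rewrite subrr normr0 mul1r.
by move=> x x01; rewrite [RHS]fE.
Qed.

Lemma near01 (x : R) : 0 < x < 1 -> \forall y \near x, 0 < y < 1.
Proof.
move=> /andP[x0 x1]; near=> y; apply/andP; split.
- by near: y; exact: lt_nbhsr.
- by near: y; exact: lt_nbhsl.
Unshelve. all: by end_near. Qed.

Lemma rprim_derive f g : rprim f g ->
  {ae mu, forall x, 0 < x < 1 -> derivable f x 1 /\ derive1 f x = g x}.
Proof.
move=> [Ig fE]; apply: aeS (derive_Rintegral Ig) _ => x Hx x01.
set J := (fun y : R => \int[mu]_(t in `[0, y]) g t) in Hx; have [dx ex] := Hx x01.
pose G (y : R) := f 0 + J y.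
have [GD eG] := derive1D_at (@derivable_cst _ _ _ (f 0) x 1) dx.
have FE : \forall y \near x, G y = f y.
  near=> y; rewrite /G -fE//.
  by have /andP[? ?] : 0 < y < 1; [near: y; exact: near01|rewrite !ltW].
split; first exact: near_eq_derivable GD.
by rewrite derive1E -(near_eq_derive _ FE)//= -derive1E eG ex derive1_cst add0r.
Unshelve. all: by end_near. Qed.

(** Fundamental theorem of calculus for absolutely continuous functions. *)
Lemma rprimP f g : rint01 g -> rabs_continuous01 f ->
  {ae mu, forall x, 0 < x < 1 -> derivable f x 1 /\ derive1 f x = g x} ->
  rprim f g.
Proof.
move=> Ig acf dfg; split => // x x01.
pose h (x : R) := f x - \int[mu]_(t in `[0, x]) g t.
have ach : rabs_continuous01 h.
  by apply: rabs_continuousD => //; apply: rabs_continuousN; exact: rabs_continuous_Rintegral.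
have /(rabs_continuous_cst ach)/(_ _ x01) :
    {ae mu, forall x, 0 < x < 1 -> derivable h x 1 /\ derive1 h x = 0}.
  apply: aeS2 dfg (derive_Rintegral Ig) _ => y Hf Hg y01.
  have [df ef] := Hf y01; have [dg eg] := Hg y01.
  by have [? ->] := derive1B_at df dg; rewrite ef eg subrr.
rewrite /h set_itv1 Rintegral_set1 subr0 => <-.
by rewrite subrK.
Qed.

Lemma rint01_cont f : {within `[0, 1], continuous f} -> rint01 f.
Proof.
by move=> cf; apply: continuous_compact_integrable => //; exact: segment_compact.
Qed.

Lemma rint01M f g : {within `[0, 1], continuous f} -> rint01 g ->
  rint01 (fun x => f x * g x).
Proof.
move=> cf Ig; have [C C0 fC] := within_continuous_bounded cf.
have cE : (EFin \o (fun x => f x * g x)) = (fun x => (f x)%:E * (EFin \o g) x)%E by [].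
rewrite /rint01 cE; apply: integrableMr => //.
- exact: subspace_continuous_measurable_fun.
- exists C; split; first exact: num_real.
  by move=> M CM x /= x01; rewrite (le_trans (fC _ _) (ltW CM)).
Qed.

Lemma rint01Mr f g : rint01 f -> {within `[0, 1], continuous g} ->
  rint01 (fun x => f x * g x).
Proof.
move=> If cg; have := rint01M cg If; congr rint01.
by apply/funext => x; rewrite mulrC.
Qed.

Lemma rint01D f g : rint01 f -> rint01 g -> rint01 (fun x => f x + g x).
Proof. by rewrite /rint01 => If Ig; apply: (integrableD _ If Ig). Qed.

Lemma rint01_norm f : rint01 f -> rint01 (fun x => `|f x|).
Proof. exact: integrable_norm. Qed.

Lemma rint01_dom f g : measurable_fun (`[0, 1] : set R) f -> rint01 g ->
  (forall x, 0 <= x <= 1 -> `|f x| <= g x) -> rint01 f.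
Proof.
rewrite /rint01 => mf Ig fg; apply: (le_integrable _ _ _ Ig) => //.
  exact/measurable_EFinP.
move=> x /=; rewrite in_itv/= lee_fin => x01.
by rewrite (le_trans (fg _ x01))// ler_norm.
Qed.

Lemma rint01Z (c : R) f : rint01 f -> rint01 (fun x => c * f x).
Proof.
move=> If; apply: (@rint01M (fun=> c)) => //.
by apply: continuous_subspaceT; exact: cst_continuous.
Qed.

Lemma rint01N f : rint01 f -> rint01 (fun x => - f x).
Proof. by move=> If; exact: (integrableN If). Qed.

Lemma rprimD f f' g g' : rprim f f' -> rprim g g' ->
  rprim (fun x => f x + g x) (fun x => f' x + g' x).
Proof.
move=> [If fE] [Ig gE]; split; first exact: rint01D.
move=> x x01; rewrite fE// gE// RintegralD//; first by ring.
- by apply: rint01_sub If _ _ => //; case/andP: x01.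
- by apply: rint01_sub Ig _ _ => //; case/andP: x01.
Qed.

Lemma rprimN f f' : rprim f f' -> rprim (fun x => - f x) (fun x => - f' x).
Proof.
move=> [If fE]; split; first exact: rint01N.
move=> x x01; rewrite fE// opprD.
under [in RHS]eq_Rintegral do rewrite -mulN1r.
rewrite RintegralZl// ?mulN1r//.
by apply: rint01_sub If _ _ => //; case/andP: x01.
Qed.

Lemma rprim_cont f g : rprim f g -> {within `[0, 1], continuous f}.
Proof. by move=> /rprim_ac/rabs_continuous_cont. Qed.

(** Products of primitives are primitives: integration by parts. *)
Lemma rprimM f f' g g' : rprim f f' -> rprim g g' ->
  rprim (fun x => f x * g x) (fun x => f' x * g x + f x * g' x).
Proof.
move=> pf pg; apply: rprimP.
- apply: rint01D; last by apply: rint01M (rprim_cont pf) _; case: pg.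
  have -> : (fun x => f' x * g x) = (fun x => g x * f' x).
    by apply/funext => x; rewrite mulrC.
  by apply: rint01M (rprim_cont pg) _; case: pf.
- exact: rabs_continuousM (rprim_ac pf) (rprim_ac pg).
- apply: aeS2 (rprim_derive pf) (rprim_derive pg) _ => x Hf Hg x01.
  have [df ef] := Hf x01; have [dg eg] := Hg x01.
  by have [? ->] := derive1M_at df dg; rewrite ef eg.
Qed.

Lemma rprim_eq f f' g g' : rprim f f' ->
  (forall x, 0 <= x <= 1 -> f x = g x) -> (forall x, 0 <= x <= 1 -> f' x = g' x) ->
  rprim g g'.
Proof.
move=> [If fE] fg f'g'; split.
  move: If; rewrite /rint01; apply: eq_integrable => // x; rewrite inE/= in_itv/= => x01.
  by rewrite /= f'g'.
move=> x x01; rewrite -!fg//; last by rewrite lexx ler01.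
rewrite fE//; congr (_ + _); apply: eq_Rintegral => t.
rewrite inE/= in_itv/= => /andP[t0 tx]; apply: f'g'.
by rewrite t0 (le_trans tx)//; case/andP: x01.
Qed.

Lemma rprim_Rintegral f : rint01 f -> rprim (fun x => \int[mu]_(t in `[0, x]) f t) f.
Proof. by move=> If; split => // x x01; rewrite set_itv1 Rintegral_set1 add0r. Qed.

Lemma rprim_cst (c : R) : rprim (fun=> c) (fun=> 0).
Proof.
split; first exact: integrable0.
by move=> x x01; rewrite Rintegral_cst//= mul0r addr0.
Qed.

Lemma within_contD f g : {within `[0, 1], continuous f} ->
  {within `[0, 1], continuous g} -> {within `[0, 1], continuous (fun x => f x + g x)}.
Proof.
move=> /subspace_continuousP cf /subspace_continuousP cg; apply/subspace_continuousP => x x01.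
by apply: cvgD; [exact: cf|exact: cg].
Qed.

Lemma within_contB f g : {within `[0, 1], continuous f} ->
  {within `[0, 1], continuous g} -> {within `[0, 1], continuous (fun x => f x - g x)}.
Proof.
move=> /subspace_continuousP cf /subspace_continuousP cg; apply/subspace_continuousP => x x01.
by apply: cvgB; [exact: cf|exact: cg].
Qed.

Lemma within_contM f g : {within `[0, 1], continuous f} ->
  {within `[0, 1], continuous g} -> {within `[0, 1], continuous (fun x => f x * g x)}.
Proof.
move=> /subspace_continuousP cf /subspace_continuousP cg; apply/subspace_continuousP => x x01.
by apply: cvgM; [exact: cf|exact: cg].
Qed.

Lemma rprim_C1 f f' : (forall x : R, is_derive x 1 f (f' x)) -> continuous f' -> rprim f f'.
Proof.
move=> df cf'; split.
  by apply: rint01_cont; exact: continuous_subspaceT.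
move=> x /andP[]; rewrite le_eqVlt => /orP[/eqP <- _|x0 x1].
  by rewrite set_itv1 Rintegral_set1 addr0.
have cf : continuous f.
  by move=> y; apply/differentiable_continuous/derivable1_diffP; have [] := df y.
have := @continuous_FTC2 R f' f 0 x x0.
rewrite /Rintegral => ->.
- by rewrite -EFinB/= addrC subrK.
- exact: continuous_subspaceT.
- split.
  + by move=> y _; have [] := df y.
  + exact/cvg_at_right_filter/cf.
  + exact/cvg_at_left_filter/cf.
- by move=> y _; rewrite derive1E; have [_] := df y.
Qed.

End ac_real.
(** * Complex-valued functions on [0,1] *)

Section cmod_theory.
Variable R : realType.
Implicit Types (z w : R[i]).

Lemma cmodE z : cmod z = Num.sqrt (complex.Re z ^+ 2 + complex.Im z ^+ 2).
Proof. by case: z. Qed.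

Lemma cmod_ge0 z : 0 <= cmod z.
Proof. by rewrite cmodE sqrtr_ge0. Qed.

Lemma cmod0 : cmod (0 : R[i]) = 0.
Proof. exact: ComplexField.Normc.normc0. Qed.

Lemma cmod1 : cmod (1 : R[i]) = 1.
Proof. exact: ComplexField.Normc.normc1. Qed.

Lemma cmodM z w : cmod (z * w) = cmod z * cmod w.
Proof. exact: ComplexField.Normc.normcM. Qed.

Lemma cmodD z w : cmod (z + w) <= cmod z + cmod w.
Proof. exact: le_normcD. Qed.

Lemma cmodN z : cmod (- z) = cmod z.
Proof. exact: normcN. Qed.

Lemma cmodB z w : cmod (z - w) <= cmod z + cmod w.
Proof. by rewrite -[cmod w]cmodN; exact: cmodD. Qed.

Lemma cmodX z n : cmod (z ^+ n) = cmod z ^+ n.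
Proof. by elim: n => [|n IH]; rewrite ?expr0 ?cmod1// !exprS cmodM IH. Qed.

Lemma sqr_cmod z : cmod z ^+ 2 = complex.Re z ^+ 2 + complex.Im z ^+ 2.
Proof. by rewrite cmodE sqr_sqrtr// addr_ge0 ?sqr_ge0. Qed.

Lemma Re_le_cmod z : `|complex.Re z| <= cmod z.
Proof.
by rewrite -(@ler_pXn2r _ 2)// ?nnegrE ?cmod_ge0// sqr_cmod real_normK ?num_real// lerDl sqr_ge0.
Qed.

Lemma Im_le_cmod z : `|complex.Im z| <= cmod z.
Proof.
by rewrite -(@ler_pXn2r _ 2)// ?nnegrE ?cmod_ge0// sqr_cmod real_normK ?num_real// lerDr sqr_ge0.
Qed.

Lemma cmod_real (x : R) : cmod x%:C = `|x|.
Proof. by rewrite cmodE /= expr0n addr0 sqrtr_sqr. Qed.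

Lemma cmod_le_ReIm z : cmod z <= `|complex.Re z| + `|complex.Im z|.
Proof.
rewrite -(@ler_pXn2r _ 2)// ?nnegrE ?cmod_ge0 ?addr_ge0//.
rewrite sqr_cmod sqrrD !real_normK ?num_real// -addrA lerD2l addrC lerDl.
by rewrite mulrn_wge0// mulr_ge0.
Qed.

Lemma ReM z w : complex.Re (z * w) =
  complex.Re z * complex.Re w - complex.Im z * complex.Im w.
Proof. by case: z; case: w. Qed.

Lemma ImM z w : complex.Im (z * w) =
  complex.Re z * complex.Im w + complex.Im z * complex.Re w.
Proof. by case: z; case: w. Qed.

Lemma ReD z w : complex.Re (z + w) = complex.Re z + complex.Re w.
Proof. by case: z; case: w. Qed.

Lemma ImD z w : complex.Im (z + w) = complex.Im z + complex.Im w.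
Proof. by case: z; case: w. Qed.

Lemma ReN z : complex.Re (- z) = - complex.Re z. Proof. by case: z. Qed.

Lemma ImN z : complex.Im (- z) = - complex.Im z. Proof. by case: z. Qed.

Lemma complex_eqP z w : complex.Re z = complex.Re w -> complex.Im z = complex.Im w ->
  z = w.
Proof. by case: z; case: w => /= ? ? ? ? -> ->. Qed.

Lemma cexp0 : cexp (0 : R[i]) = 1.
Proof. by rewrite /cexp/= expR0 cos0 sin0 mulr1 mulr0. Qed.

Lemma cexpD z w : cexp (z + w) = cexp z * cexp w.
Proof.
apply: complex_eqP; rewrite ?ReM ?ImM /= ?ReD ?ImD expRD ?cosD ?sinD; ring.
Qed.

Lemma cmod_cexp z : cmod (cexp z) = expR (complex.Re z).
Proof.
rewrite cmodE /= !exprMn -mulrDr cos2Dsin2 mulr1 sqrtr_sqr ger0_norm// expR_ge0.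
Qed.

End cmod_theory.

Section complex_functions.
Variable R : realType.
Notation mu := (@lebesgue_measure R).
Implicit Types (f g : R -> R[i]).

(** Integrability on [0,1] of a complex-valued function. *)
Definition cint01 f : Prop :=
  rint01 (fun x => complex.Re (f x)) /\ rint01 (fun x => complex.Im (f x)).

(** [cprim f g]: on [0,1], [f] is the primitive of the integrable complex
    function [g]. *)
Definition cprim f g : Prop :=
  rprim (fun x => complex.Re (f x)) (fun x => complex.Re (g x)) /\
  rprim (fun x => complex.Im (f x)) (fun x => complex.Im (g x)).

Lemma cprim_int f g : cprim f g -> cint01 g.
Proof. by move=> [[? _] [? _]]. Qed.

Lemma cprimE f g x : cprim f g -> 0 <= x <= 1 -> f x = f 0 + cintegral 0 x g.
Proof.
move=> [[_ fR] [_ fI]] x01; apply: complex_eqP.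
- by rewrite fR// ReD.
- by rewrite fI// ImD.
Qed.

Lemma cprim_cintegral f : cint01 f -> cprim (cintegral 0 ^~ f) f.
Proof. by move=> [fR fI]; split; exact: rprim_Rintegral. Qed.

Lemma cintegral_id f (x : R) : cintegral x x f = 0.
Proof. by rewrite /cintegral !set_itv1 !Rintegral_set1. Qed.

Lemma cprim_cst (c : R[i]) : cprim (fun=> c) (fun=> 0).
Proof. by split; exact: rprim_cst. Qed.

Lemma rprim_ext (f f' g g' : R -> R) : rprim f f' -> f =1 g -> f' =1 g' -> rprim g g'.
Proof. by move=> /[swap] /funext -> /[swap] /funext ->. Qed.

Lemma cprim_ext (f f' g g' : R -> R[i]) : cprim f f' -> f =1 g -> f' =1 g' -> cprim g g'.
Proof. by move=> /[swap] /funext -> /[swap] /funext ->. Qed.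

Lemma cprimD f f' g g' : cprim f f' -> cprim g g' ->
  cprim (fun x => f x + g x) (fun x => f' x + g' x).
Proof.
move=> [fR fI] [gR gI]; split.
- by apply: rprim_ext (rprimD fR gR) _ _ => x; rewrite ReD.
- by apply: rprim_ext (rprimD fI gI) _ _ => x; rewrite ImD.
Qed.

Lemma cprimN f f' : cprim f f' -> cprim (fun x => - f x) (fun x => - f' x).
Proof.
move=> [fR fI]; split.
- by apply: rprim_ext (rprimN fR) _ _ => x; rewrite ReN.
- by apply: rprim_ext (rprimN fI) _ _ => x; rewrite ImN.
Qed.

Lemma cprimM f f' g g' : cprim f f' -> cprim g g' ->
  cprim (fun x => f x * g x) (fun x => f' x * g x + f x * g' x).
Proof.
move=> [fR fI] [gR gI]; split.
- apply: rprim_ext (rprimD (rprimM fR gR) (rprimN (rprimM fI gI))) _ _ => x.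
    by rewrite ReM.
  by rewrite ReD !ReM; ring.
- apply: rprim_ext (rprimD (rprimM fR gI) (rprimM fI gR)) _ _ => x.
    by rewrite ImM.
  by rewrite ImD !ImM; ring.
Qed.

Lemma cprim_eq f f' g g' : cprim f f' ->
  (forall x, 0 <= x <= 1 -> f x = g x) -> (forall x, 0 <= x <= 1 -> f' x = g' x) ->
  cprim g g'.
Proof.
move=> [fR fI] fg f'g'; split.
- by apply: rprim_eq fR _ _ => x x01; rewrite ?fg ?f'g'.
- by apply: rprim_eq fI _ _ => x x01; rewrite ?fg ?f'g'.
Qed.

Lemma cprim_cont f g : cprim f g -> in_C01 f.
Proof. by move=> [/rprim_cont fR /rprim_cont fI]. Qed.

Lemma cprim_uniq f g h x : cprim f h -> cprim g h -> f 0 = g 0 -> 0 <= x <= 1 ->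
  f x = g x.
Proof. by move=> pf pg fg0 x01; rewrite (cprimE pf)// (cprimE pg)// fg0. Qed.

Lemma cint01D f g : cint01 f -> cint01 g -> cint01 (fun x => f x + g x).
Proof.
by move=> If Ig; have := cprimD (cprim_cintegral If) (cprim_cintegral Ig) => /cprim_int.
Qed.

Lemma cint01N f : cint01 f -> cint01 (fun x => - f x).
Proof. by move=> If; have := cprimN (cprim_cintegral If) => /cprim_int. Qed.

Lemma cint01M f g : in_C01 f -> cint01 g -> cint01 (fun x => f x * g x).
Proof.
move=> [fR fI] [gR gI]; split.
- have := rint01D (rint01M fR gR) (rint01N (rint01M fI gI)).
  by congr rint01; apply/funext => x; rewrite ReM.
- have := rint01D (rint01M fR gI) (rint01M fI gR).
  by congr rint01; apply/funext => x; rewrite ImM.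
Qed.

Lemma cint01Mr f g : cint01 f -> in_C01 g -> cint01 (fun x => f x * g x).
Proof.
move=> If cg; have := cint01M cg If; congr cint01.
by apply/funext => x; rewrite mulrC.
Qed.

Lemma measurable_cmod (D : set R) f : measurable D ->
  measurable_fun D (fun x => complex.Re (f x)) ->
  measurable_fun D (fun x => complex.Im (f x)) ->
  measurable_fun D (fun x => cmod (f x)).
Proof.
move=> mD mR mI.
have -> : (fun x => cmod (f x)) =
    Num.sqrt \o (fun x => complex.Re (f x) ^+ 2 + complex.Im (f x) ^+ 2).
  by apply/funext => x; rewrite cmodE.
apply: measurableT_comp.
  by apply: continuous_measurable_fun; exact: sqrt_continuous.
by apply: measurable_funD; apply: measurable_funX.
Qed.

Lemma cint01_meas f : cint01 f ->
  [/\ measurable_fun (`[0, 1] : set R) (fun x => complex.Re (f x)),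
      measurable_fun (`[0, 1] : set R) (fun x => complex.Im (f x)) &
      measurable_fun (`[0, 1] : set R) (fun x => cmod (f x))].
Proof.
move=> [/integrableP[/measurable_EFinP mR _] /integrableP[/measurable_EFinP mI _]].
by split => //; apply: measurable_cmod.
Qed.

Lemma cint01_cmod f : cint01 f -> rint01 (fun x => cmod (f x)).
Proof.
move=> If; have [mR mI mf] := cint01_meas If; case: If => fR fI.
have Ifs := rint01D (rint01_norm fR) (rint01_norm fI).
apply: (rint01_dom _ Ifs) => // x _; rewrite ger0_norm ?cmod_ge0//; exact: cmod_le_ReIm.
Qed.

Lemma rint01_cmodK f : measurable_fun (`[0, 1] : set R) (fun x => complex.Re (f x)) ->
  measurable_fun (`[0, 1] : set R) (fun x => complex.Im (f x)) ->
  rint01 (fun x => cmod (f x)) -> cint01 f.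
Proof.
move=> mR mI If; split; apply: (rint01_dom _ If) => // x _.
- exact: Re_le_cmod.
- exact: Im_le_cmod.
Qed.

End complex_functions.

(** The modulus of a complex integral is at most the integral of the modulus:
    with [z] the integral, integrate [Re (conj z * f) <= |z| |f|]. *)
Lemma sqrt_Rintegral_le (d : measure_display) (T : measurableType d) (R : realType)
    (nu : {measure set T -> \bar R}) (D : set T) (u v w : T -> R) :
  measurable D -> nu.-integrable D (EFin \o u) -> nu.-integrable D (EFin \o v) ->
  nu.-integrable D (EFin \o w) ->
  (forall x, D x -> Num.sqrt (u x ^+ 2 + v x ^+ 2) <= w x) ->
  Num.sqrt ((\int[nu]_(x in D) u x) ^+ 2 + (\int[nu]_(x in D) v x) ^+ 2) <=
  \int[nu]_(x in D) w x.
Proof.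
move=> mD Iu Iv Iw uvw.
set a := \int[nu]_(x in D) u x; set b := \int[nu]_(x in D) v x.
set s := Num.sqrt _.
have s2 : s ^+ 2 = a ^+ 2 + b ^+ 2 by rewrite sqr_sqrtr// addr_ge0 ?sqr_ge0.
have s0 : 0 <= s by exact: sqrtr_ge0.
have [s00|sN0] := eqVneq s 0.
  rewrite s00; apply: Rintegral_ge0 => x Dx.
  by apply: le_trans (uvw x Dx); exact: sqrtr_ge0.
have sgt0 : 0 < s by rewrite lt_neqAle eq_sym sN0.
rewrite -(ler_pM2l sgt0) -expr2 s2.
have Iau : nu.-integrable D (EFin \o (fun x => a * u x)) by exact: (integrableZl mD a Iu).
have Ibv : nu.-integrable D (EFin \o (fun x => b * v x)) by exact: (integrableZl mD b Iv).
have Isw : nu.-integrable D (EFin \o (fun x => s * w x)) by exact: (integrableZl mD s Iw).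
have -> : a ^+ 2 + b ^+ 2 = \int[nu]_(x in D) (a * u x + b * v x).
  by rewrite RintegralD// !RintegralZl// !expr2.
rewrite -RintegralZl//; apply: le_Rintegral => //.
  exact: (integrableD mD Iau Ibv).
move=> x Dx.
set t := Num.sqrt (u x ^+ 2 + v x ^+ 2).
have t2 : t ^+ 2 = u x ^+ 2 + v x ^+ 2 by rewrite sqr_sqrtr// addr_ge0 ?sqr_ge0.
have t0 : 0 <= t by exact: sqrtr_ge0.
apply: (@le_trans _ _ (s * t)); last by rewrite ler_wpM2l ?uvw.
apply: (le_trans (ler_norm _)).
rewrite -(@ler_pXn2r _ 2)// ?nnegrE ?mulr_ge0// real_normK ?num_real//.
rewrite exprMn s2 t2 -subr_ge0.
have -> : (a ^+ 2 + b ^+ 2) * (u x ^+ 2 + v x ^+ 2) - (a * u x + b * v x) ^+ 2 =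
  (a * v x - b * u x) ^+ 2 by ring.
exact: sqr_ge0.
Qed.

Section complex_bounds.
Variable R : realType.
Notation mu := (@lebesgue_measure R).
Implicit Types (f g : R -> R[i]).

Lemma cmod_cintegral_le f (x : R) (w : R -> R) : cint01 f -> rint01 w -> 0 <= x <= 1 ->
  (forall t, 0 <= t <= 1 -> cmod (f t) <= w t) ->
  cmod (cintegral 0 x f) <= \int[mu]_(t in `[0, x]) w t.
Proof.
move=> [fR fI] Iw /andP[x0 x1] fw; rewrite cmodE /=.
apply: sqrt_Rintegral_le => //; try exact: rint01_sub.
move=> t /=; rewrite in_itv/= => /andP[t0 tx].
by rewrite -cmodE; apply: fw; rewrite t0 (le_trans tx).
Qed.

Lemma Rintegral01_mono (w : R -> R) (x y : R) : rint01 w ->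
  (forall t, 0 <= t <= 1 -> 0 <= w t) -> 0 <= x -> x <= y -> y <= 1 ->
  \int[mu]_(t in `[0, x]) w t <= \int[mu]_(t in `[0, y]) w t.
Proof.
move=> Iw w0 x0 xy y1; rewrite -subr_ge0 Rintegral_itv_split//.
apply: Rintegral_ge0 => t /=; rewrite in_itv/= => /andP[xt ty].
by apply: w0; rewrite (le_trans x0 (ltW xt)) (le_trans ty).
Qed.

Lemma Rintegral01_le (v w : R -> R) (x : R) : rint01 v -> rint01 w -> 0 <= x <= 1 ->
  (forall t, 0 <= t <= 1 -> v t <= w t) ->
  \int[mu]_(t in `[0, x]) v t <= \int[mu]_(t in `[0, x]) w t.
Proof.
move=> Iv Iw /andP[x0 x1] vw; apply: le_Rintegral; first exact: measurable_itv.
- exact: rint01_sub.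
- exact: rint01_sub.
- by move=> t /=; rewrite in_itv/= => /andP[t0 tx]; apply: vw; rewrite t0 (le_trans tx).
Qed.

Lemma cmod_cprim_le f g (x : R) (w : R -> R) : cprim f g -> f 0 = 0 -> rint01 w ->
  0 <= x <= 1 -> (forall t, 0 <= t <= 1 -> cmod (g t) <= w t) ->
  cmod (f x) <= \int[mu]_(t in `[0, x]) w t.
Proof.
move=> pf f0 Iw x01 gw; rewrite (cprimE pf)// f0 add0r.
by apply: cmod_cintegral_le => //; exact: cprim_int pf.
Qed.

Lemma cmod_cont f : in_C01 f -> {within `[0, 1], continuous (fun x => cmod (f x))}.
Proof.
move=> [fR fI].
have -> : (fun x => cmod (f x)) =
    (fun x => Num.sqrt (complex.Re (f x) * complex.Re (f x) + complex.Im (f x) * complex.Im (f x))).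
  by apply/funext => x; rewrite cmodE !expr2.
have cs := within_contD (within_contM fR fR) (within_contM fI fI).
by move=> x; exact: (continuous_comp (cs x) (@sqrt_continuous R _)).
Qed.

Lemma in_C01D f g : in_C01 f -> in_C01 g -> in_C01 (fun x => f x + g x).
Proof.
move=> [fR fI] [gR gI]; split.
- have -> : (fun x => complex.Re (f x + g x)) =
    (fun x => complex.Re (f x) + complex.Re (g x)) by apply/funext => x; rewrite ReD.
  exact: within_contD.
- have -> : (fun x => complex.Im (f x + g x)) =
    (fun x => complex.Im (f x) + complex.Im (g x)) by apply/funext => x; rewrite ImD.
  exact: within_contD.
Qed.

Lemma rprim_lin (c : R) : rprim (fun t => c * t) (fun=> c).
Proof.
apply: rprim_C1; last exact: cst_continuous.
move=> x; have := @is_deriveZ R R R id c x 1 1 _.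
by rewrite [c *: 1]mulr1; apply.
Qed.

Lemma rprim_comp_lin (F F' : R -> R) (c : R) : (forall x : R, is_derive x 1 F (F' x)) ->
  continuous F' -> rprim (fun t => F (c * t)) (fun t => c * F' (c * t)).
Proof.
move=> dF cF'; apply: rprim_C1.
  move=> x.
  have dl : is_derive x (1 : R) (fun t : R => c * t) c.
    by have := @is_deriveZ R R R id c x 1 1 _; rewrite [c *: 1]mulr1; apply.
  have [dF1 dF2] := dF (c * x); have [dl1 dl2] := dl.
  have dc : derivable (F \o (fun t : R => c * t)) x 1.
    apply/derivable1_diffP; apply: differentiable_comp.
      exact/derivable1_diffP.
    exact/derivable1_diffP.
  apply: (DeriveDef dc).
  have := @derive1_comp R (fun t : R => c * t) F x dl1 dF1.
  by rewrite !derive1E dF2 dl2 mulrC.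
move=> x; apply: continuousM; first exact: cst_continuous.
apply: (@continuous_comp _ _ _ (fun t : R => c * t) F'); last exact: cF'.
by apply: continuousM; [exact: cst_continuous|move=> ?].
Qed.

Lemma cprim_cexp (z : R[i]) :
  cprim (fun t : R => cexp (z * t%:C)) (fun t => z * cexp (z * t%:C)).
Proof.
pose a := complex.Re z; pose b := complex.Im z.
have pe : rprim (fun t => expR (a * t)) (fun t => a * expR (a * t)).
  by apply: rprim_comp_lin => // x; exact: continuous_expR.
have pc : rprim (fun t => cos (b * t)) (fun t => b * - sin (b * t)).
  by apply: rprim_comp_lin => x; apply: continuousN; exact: continuous_sin.
have ps : rprim (fun t => sin (b * t)) (fun t => b * cos (b * t)).
  by apply: rprim_comp_lin => x; exact: continuous_cos.
have zE (t : R) : (complex.Re (z * t%:C) = a * t) * (complex.Im (z * t%:C) = b * t).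
  by rewrite ReM ImM /= !mulr0 subr0 add0r.
split.
- apply: rprim_ext (rprimM pe pc) _ _ => t; first by rewrite /= !zE.
  by rewrite ReM /= !zE; rewrite /a /b; ring.
- apply: rprim_ext (rprimM pe ps) _ _ => t; first by rewrite /= !zE.
  by rewrite ImM /= !zE; rewrite /a /b; ring.
Qed.

Lemma cprimZ (c : R[i]) f f' : cprim f f' -> cprim (fun x => c * f x) (fun x => c * f' x).
Proof.
move=> pf; apply: cprim_ext (cprimM (cprim_cst c) pf) _ _ => // x.
by rewrite mul0r add0r.
Qed.

Lemma cprim_real (f f' : R -> R) : rprim f f' ->
  cprim (fun x => (f x)%:C) (fun x => (f' x)%:C).
Proof. by move=> pf; split => //=; exact: rprim_cst. Qed.

Lemma rprimX (k k' : R -> R) (n : nat) : rprim k k' ->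
  rprim (fun x => k x ^+ n.+1 / n.+1`!%:R) (fun x => k' x * (k x ^+ n / n`!%:R)).
Proof.
move=> pk; elim: n => [|n IH].
  by apply: rprim_ext pk _ _ => x; rewrite ?expr1 ?expr0 !divr1// mulr1.
have nz m : (m`!%:R : R) != 0 by rewrite pnatr_eq0 -lt0n fact_gt0.
have := rprimM (rprim_cst (n.+2%:R^-1)) (rprimM pk IH).
move=> /rprim_ext; apply=> x.
- by rewrite [n.+2`!]factS natrM [k x ^+ n.+2]exprS invfM; ring.
- have -> : k x * (k' x * (k x ^+ n / n`!%:R)) =
      n.+1%:R * (k' x * (k x ^+ n.+1 / n.+1`!%:R)).
    rewrite [n.+1`!]factS natrM [k x ^+ n.+1]exprS invfM.
    transitivity ((n.+1%:R * n.+1%:R^-1) * (k x * (k' x * (k x ^+ n / n`!%:R)))); last by ring.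
    by rewrite mulfV ?mul1r// pnatr_eq0.
  rewrite mul0r add0r -[X in _ * (X + _)]mul1r -mulrDl addrC natr1 mulrA mulVf ?mul1r//.
Qed.

(** The exponential series, through its Taylor remainders: each one is the
    primitive of [z] times the previous one. *)
Lemma cexp_series_remainder (z : R[i]) (n : nat) :
  exists2 r : R -> R[i],
    (forall t, r t = cexp (z * t%:C) - \sum_(0 <= m < n) (m`!%:R)^-1 * (z * t%:C) ^+ m) &
    (forall t, 0 <= t <= 1 -> cmod (r t) <= expR `|complex.Re z| * (cmod z ^+ n * (t ^+ n / n`!%:R))).
Proof.
elim: n => [|n [r rE rB]].
  exists (fun t => cexp (z * t%:C)) => t; first by rewrite big_nil subr0.
  move=> /andP[t0 t1]; rewrite !expr0 fact0 divr1 !mulr1 cmod_cexp ler_expR.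
  rewrite ReM /= mulr0 subr0 (le_trans (ler_norm _))// normrM (ger0_norm t0).
  by rewrite ler_piMr.
have pX m : cprim (fun t : R => (m.+1`!%:R)^-1 * (z * t%:C) ^+ m.+1)
    (fun t => z * ((m`!%:R)^-1 * (z * t%:C) ^+ m)).
  have := cprimZ (z ^+ m.+1) (cprim_real (rprimX m (rprim_lin 1))).
  have CE (u : R) k : ((u ^+ k / k`!%:R)%:C : R[i]) = u%:C ^+ k * (k`!%:R)^-1.
    by rewrite rmorphM rmorphXn fmorphV rmorph_nat.
  move=> /cprim_ext; apply=> t; rewrite !mul1r CE exprMn ?exprS; ring.
have psum m : cprim (fun t : R => \sum_(0 <= i < m.+1) (i`!%:R)^-1 * (z * t%:C) ^+ i)
    (fun t => z * \sum_(0 <= i < m) (i`!%:R)^-1 * (z * t%:C) ^+ i).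
  elim: m => [|m IH].
    apply: cprim_ext (cprim_cst 1) _ _ => t.
      by rewrite big_nat1 expr0 fact0 invr1 mulr1.
    by rewrite big_nil mulr0.
  apply: cprim_ext (cprimD IH (pX m)) _ _ => t.
    by rewrite [RHS]big_nat_recr.
  by rewrite [in RHS]big_nat_recr//= mulrDr.
pose r' (t : R) := cexp (z * t%:C) - \sum_(0 <= m < n.+1) (m`!%:R)^-1 * (z * t%:C) ^+ m.
have pr' : cprim r' (fun t => z * r t).
  apply: cprim_ext (cprimD (cprim_cexp z) (cprimN (psum n))) _ _ => // t.
  by rewrite rE mulrBr.
exists r' => // t t01.
have r'0 : r' 0 = 0.
  rewrite /r' mulr0 cexp0 big_nat_recl// expr0 fact0 invr1 mulr1 big1 ?addr0 ?subrr//.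
  by move=> i _; rewrite exprS mul0r mulr0.
have [It Et] : rprim (fun t : R => t ^+ n.+1 / n.+1`!%:R) (fun t => t ^+ n / n`!%:R).
  by apply: rprim_ext (rprimX n (rprim_lin 1)) _ _ => x; rewrite !mul1r.
pose C := expR `|complex.Re z| * cmod z ^+ n.+1.
apply: (le_trans (cmod_cprim_le pr' r'0 (rint01Z C It) t01 _)).
  move=> s s01; rewrite cmodM /C exprS.
  rewrite [X in _ <= X](_ : _ = cmod z * (expR `|complex.Re z| * (cmod z ^+ n * (s ^+ n / n`!%:R)))); last by ring.
  by rewrite ler_wpM2l ?cmod_ge0// rB.
rewrite RintegralZl//; last by apply: rint01_sub => //; case/andP: t01.
have := Et t t01; rewrite [0 ^+ _]exprS !mul0r add0r => <-.
by rewrite /C -mulrA.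
Qed.

Lemma cexp_series_cvg (z : R[i]) :
  (fun n => complex.Re (\sum_(0 <= m < n) (m`!%:R)^-1 * z ^+ m)) @ \oo --> complex.Re (cexp z) /\
  (fun n => complex.Im (\sum_(0 <= m < n) (m`!%:R)^-1 * z ^+ m)) @ \oo --> complex.Im (cexp z).
Proof.
set S := fun n => \sum_(0 <= m < n) (m`!%:R)^-1 * z ^+ m.
have B n : cmod (cexp z - S n) <= expR `|complex.Re z| * exp_coeff (cmod z) n.
  have [r rE /(_ 1)] := cexp_series_remainder z n.
  rewrite rE lexx ler01 /exp_coeff/= expr1n div1r => /(_ isT).
  by rewrite mulr1.
have C0 : (expR `|complex.Re z| * exp_coeff (cmod z) n) @[n --> \oo] --> (0 : R).
  rewrite -(mulr0 (expR `|complex.Re z|)); apply: cvgM; first exact: cvg_cst.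
  exact: cvg_exp_coeff.
split.
- apply/cvgrPdist_le => e e0.
  move/cvgrPdist_le : C0 => /(_ _ e0); apply: filterS => n.
  rewrite sub0r normrN => /(le_trans (ler_norm _)); apply: le_trans.
  by rewrite -ReN -ReD (le_trans (Re_le_cmod _))//; exact: B.
- apply/cvgrPdist_le => e e0.
  move/cvgrPdist_le : C0 => /(_ _ e0); apply: filterS => n.
  rewrite sub0r normrN => /(le_trans (ler_norm _)); apply: le_trans.
  by rewrite -ImN -ImD (le_trans (Im_le_cmod _))//; exact: B.
Qed.

Lemma mx22_eqP (A B : 'M[R[i]]_2) :
  A 0 0 = B 0 0 -> A 0 1 = B 0 1 -> A 1 0 = B 1 0 -> A 1 1 = B 1 1 -> A = B.
Proof.
move=> H1 H2 H3 H4; apply/matrixP => i j.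
have o2 (k : 'I_2) : k = 0 \/ k = 1.
  by case: k => [[|[|//]]] k2; [left|right]; exact/val_inj.
by case: (o2 i) => ->; case: (o2 j) => ->.
Qed.

Lemma mx22E (a b c d : R[i]) :
  (mx22 a b c d 0 0 = a) * (mx22 a b c d 0 1 = b) *
  (mx22 a b c d 1 0 = c) * (mx22 a b c d 1 1 = d).
Proof. by rewrite !mxE. Qed.

Lemma mul22E (A B : 'M[R[i]]_2) i j : (A *m B) i j = A i 0 * B 0 j + A i 1 * B 1 j.
Proof. by rewrite mxE big_ord_recl big_ord1; congr (_ + _ * _); congr (_ _ _); exact/val_inj. Qed.

Lemma diag22X (a d : R[i]) n : mx22 a 0 0 d ^+ n = mx22 (a ^+ n) 0 0 (d ^+ n).
Proof.
elim: n => [|n IH].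
  by rewrite !expr0; apply: mx22_eqP; rewrite !mx22E ?mxE.
rewrite exprS IH; apply: mx22_eqP; rewrite [_ * _]/(_ *m _) mul22E !mx22E;
  by rewrite ?exprS ?(mulr0, mul0r, addr0, add0r).
Qed.

(** The limit of the matrix exponential series at a diagonal matrix. *)
Lemma expmx_diag (a d : R[i]) : expmx (mx22 a 0 0 d) = mx22 (cexp a) 0 0 (cexp d).
Proof.
have P n : expmx_partial (mx22 a 0 0 d) n =
    mx22 (\sum_(0 <= m < n) (m`!%:R)^-1 * a ^+ m) 0 0 (\sum_(0 <= m < n) (m`!%:R)^-1 * d ^+ m).
  rewrite /expmx_partial; elim: n => [|n IH].
    by rewrite !big_nil; apply: mx22_eqP; rewrite !mx22E ?mxE.
  rewrite !big_nat_recr//= IH diag22X; apply: mx22_eqP;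
    by rewrite [LHS]mxE [X in _ + X]mxE !mx22E ?mulr0 ?addr0.
have [aR aI] := cexp_series_cvg a; have [dR dI] := cexp_series_cvg d.
have L0 : lim ((fun _ : nat => 0 : R) @ \oo) = 0 by apply/cvg_lim => //; exact: cvg_cst.
apply: mx22_eqP; rewrite [LHS]mxE mx22E.
- under [X in lim (X @ _)]eq_fun do rewrite P mx22E.
  under [X in _ +i* lim (X @ _)]eq_fun do rewrite P mx22E.
  by apply: complex_eqP => /=; apply/cvg_lim.
- under [X in lim (X @ _)]eq_fun do rewrite P mx22E.
  under [X in _ +i* lim (X @ _)]eq_fun do rewrite P mx22E.
  by rewrite /= L0.
- under [X in lim (X @ _)]eq_fun do rewrite P mx22E.
  under [X in _ +i* lim (X @ _)]eq_fun do rewrite P mx22E.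
  by rewrite /= L0.
- under [X in lim (X @ _)]eq_fun do rewrite P mx22E.
  under [X in _ +i* lim (X @ _)]eq_fun do rewrite P mx22E.
  by apply: complex_eqP => /=; apply/cvg_lim.
Qed.

Lemma expmx_Amx (c : R) (mu : R[i]) :
  expmx (c%:C *: Amx mu) = mx22 (cexp ('i%C * mu * c%:C)) 0 0 (cexp (- ('i%C * mu) * c%:C)).
Proof.
rewrite -expmx_diag; congr expmx; apply: mx22_eqP;
  rewrite [LHS]mxE [X in _ * X]mxE !mx22E; ring.
Qed.

End complex_bounds.
(** * Gronwall's inequality and the third-order remainder of a column *)

Section gronwall.
Variable R : realType.
Notation mu := (@lebesgue_measure R).

Lemma rprim_exp_partial (k k' : R -> R) (n : nat) : rprim k k' ->
  rprim (fun x => \sum_(0 <= i < n.+1) k x ^+ i / i`!%:R)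
        (fun x => k' x * \sum_(0 <= i < n) k x ^+ i / i`!%:R).
Proof.
move=> pk; elim: n => [|n IH].
  apply: rprim_ext (rprim_cst 1) _ _ => x.
    by rewrite big_nat1 expr0 fact0 divr1.
  by rewrite big_nil mulr0.
apply: rprim_ext (rprimD IH (rprimX n pk)) _ _ => x.
  by rewrite [RHS]big_nat_recr.
by rewrite [in RHS]big_nat_recr//= mulrDr.
Qed.

(** Gronwall's inequality with an integrable kernel [k], by iterating the
    hypothesis: [w <= M (1 + K + ... + K^(n-1)/(n-1)!) + B K^n/n!] for the
    primitive [K] of [k] and any bound [B] of [w]. *)
Lemma gronwall (w k : R -> R) (M : R) : rint01 k ->
  (forall t, 0 <= t <= 1 -> 0 <= k t) -> {within `[0, 1], continuous w} -> 0 <= M ->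
  (forall x, 0 <= x <= 1 -> w x <= M + \int[mu]_(t in `[0, x]) (k t * w t)) ->
  forall x, 0 <= x <= 1 -> w x <= M * expR (\int[mu]_(t in `[0, 1]) k t).
Proof.
move=> Ik k0 cw M0 H.
have [B B0 wB] := within_continuous_bounded cw.
pose K (x : R) := \int[mu]_(t in `[0, x]) k t.
have pK : rprim K k := rprim_Rintegral Ik.
pose S n (x : R) := \sum_(0 <= i < n) K x ^+ i / i`!%:R.
have K00 : K 0 = 0 by rewrite /K set_itv1 Rintegral_set1.
have Ikw : rint01 (fun t => k t * w t) := rint01Mr Ik cw.
have bnd n x : 0 <= x <= 1 -> w x <= M * S n x + B * (K x ^+ n / n`!%:R).
  elim: n x => [|n IH] x x01.
    by rewrite /S big_nil mulr0 add0r expr0 fact0 divr1 mulr1 (le_trans (ler_norm _))// wB.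
  apply: (le_trans (H x x01)).
  pose P (t : R) := M * S n.+1 t + B * (K t ^+ n.+1 / n.+1`!%:R).
  have pP : rprim P (fun t => k t * (M * S n t + B * (K t ^+ n / n`!%:R))).
    have := rprimD (rprimM (rprim_cst M) (rprim_exp_partial n pK))
                   (rprimM (rprim_cst B) (rprimX n pK)).
    by move=> /rprim_ext; apply => t //; rewrite /S; ring.
  case: (pP) => IP EP.
  have P0 : P 0 = M.
    rewrite /P /S K00 exprS mul0r mul0r mulr0 addr0 big_nat_recl// expr0 fact0 divr1.
    by rewrite big1 ?addr0 ?mulr1// => i _; rewrite exprS !mul0r.
  rewrite -/(P x) EP// P0 lerD2l.
  apply: Rintegral01_le => // t t01.
  by rewrite ler_wpM2l ?k0// IH.
move=> x x01.
have wK : w x <= M * expR (K x).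
  have cS : M * S n x + B * (K x ^+ n / n`!%:R) @[n --> \oo] --> M * expR (K x) + B * 0.
    apply: cvgD; apply: cvgM; try exact: cvg_cst.
      have := @is_cvg_series_exp_coeff R (K x).
      by rewrite /expR; move/cvg_ex => [l Hl]; rewrite (cvg_lim _ Hl).
    exact: cvg_exp_coeff.
  rewrite mulr0 addr0 in cS.
  rewrite -(cvg_lim _ cS)//; apply: limr_ge; first by apply/cvg_ex; eexists; exact: cS.
  by apply: nearW => n; exact: bnd.
have KK : K x <= K 1.
  by case/andP: x01 => x0 x1; rewrite /K; exact: Rintegral01_mono.
have KE : expR (K x) <= expR (K 1) by rewrite ler_expR.
exact: (le_trans wK (ler_wpM2l M0 KE)).
Qed.

(** One column [(v1, v2)] of the solution in the interaction picture.  With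
    [b], [c], [e] the successive iterated integrals, the remainders
    [u1 = v1 - 1 - c] and [u2 = v2 + b + e] solve the same homogeneous system
    with the forcing term [int q1 e]; integrating by parts
    [e = b c - int q1 b^2], this forcing is [c^2/2 - int q1 (int q1 b^2)], which
    is quadratic in [b]. *)
Lemma column_remainder (q1 q2 v1 v2 : R -> R[i]) (k : R -> R) (M : R) :
  cint01 q1 -> cint01 q2 ->
  cprim v1 (fun t => - (q1 t * v2 t)) -> cprim v2 (fun t => - (q2 t * v1 t)) ->
  v1 0 = 1 -> v2 0 = 0 -> rint01 k ->
  (forall t, 0 <= t <= 1 -> cmod (q1 t) <= k t) ->
  (forall t, 0 <= t <= 1 -> cmod (q2 t) <= k t) ->
  let b x := cintegral 0 x q2 in
  let c x := cintegral 0 x (fun t => q1 t * b t) in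
  let e x := cintegral 0 x (fun t => q2 t * c t) in
  let h x := cintegral 0 x (fun t => q1 t * b t ^+ 2) in
  (forall x, 0 <= x <= 1 ->
     cmod (c x ^+ 2 / 2 - cintegral 0 x (fun t => q1 t * h t)) <= M) ->
  forall x, 0 <= x <= 1 ->
  cmod (v1 x - 1 - c x) + cmod (v2 x + b x + e x) <= M * expR (\int[mu]_(t in `[0, 1]) k t).
Proof.
move=> I1 I2 p1 p2 v10 v20 Ik q1k q2k b c e h HM.
have pb : cprim b q2 := cprim_cintegral I2.
have pc : cprim c (fun t => q1 t * b t) := cprim_cintegral (cint01Mr I1 (cprim_cont pb)).
have pe : cprim e (fun t => q2 t * c t) := cprim_cintegral (cint01Mr I2 (cprim_cont pc)).
have ph : cprim h (fun t => q1 t * b t ^+ 2).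
  apply: cprim_cintegral; apply: cint01Mr => //.
  exact: (cprim_cont (cprimM pb pb)).
pose g x := cintegral 0 x (fun t => q1 t * h t).
have pg : cprim g (fun t => q1 t * h t) := cprim_cintegral (cint01Mr I1 (cprim_cont ph)).
have z0 f : cintegral (0 : R) 0 f = 0 := cintegral_id f 0.
have pbch : cprim (fun x => b x * c x - h x) (fun t => q2 t * c t).
  apply: cprim_ext (cprimD (cprimM pb pc) (cprimN ph)) _ _ => // t.
  by rewrite expr2; ring.
have eE x : 0 <= x <= 1 -> e x = b x * c x - h x.
  by apply: (cprim_uniq pe pbch); rewrite /b /c /h /e !z0 mul0r subrr.
(* The remainders, and the forcing term [f] in [u1 = f - int q1 u2]. *)
pose u1 x := v1 x - 1 - c x; pose u2 x := v2 x + b x + e x.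
pose f x := c x ^+ 2 / 2 - g x.
have pu2 : cprim u2 (fun t => - (q2 t * u1 t)).
  apply: cprim_ext (cprimD (cprimD p2 pb) pe) _ _ => // t.
  by rewrite /u1; ring.
have pu1 : cprim u1 (fun t => q1 t * e t - q1 t * u2 t).
  apply: cprim_ext (cprimD (cprimD p1 (cprimN (cprim_cst 1))) (cprimN pc)) _ _ => // t.
  by rewrite /u2; ring.
have pf : cprim f (fun t => q1 t * e t).
  apply: (@cprim_eq _ f (fun t => q1 t * (b t * c t - h t))) => //; last first.
    by move=> t t01; rewrite eE.
  apply: cprim_ext (cprimD (cprimZ (2^-1) (cprimM pc pc)) (cprimN pg)) _ _ => // t.
    by rewrite /f expr2; ring.
  have e2 : 2^-1 * 2 = 1 :> R[i] by rewrite mulVf// pnatr_eq0.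
  transitivity ((2^-1 * 2) * (q1 t * b t * c t) - q1 t * h t); first by ring.
  by rewrite e2; ring.
have pd : cprim (fun x => u1 x - f x) (fun t => - (q1 t * u2 t)).
  by apply: cprim_ext (cprimD pu1 (cprimN pf)) _ _ => // t; ring.
have cu1 := cmod_cont (cprim_cont pu1); have cu2 := cmod_cont (cprim_cont pu2).
pose w x := cmod (u1 x) + cmod (u2 x).
have cw : {within `[0, 1], continuous w} := within_contD cu1 cu2.
have k0 t : 0 <= t <= 1 -> 0 <= k t.
  by move=> t01; apply: le_trans (q1k t t01); exact: cmod_ge0.
have M0 : 0 <= M.
  by have := HM 0; rewrite lexx ler01 => /(_ isT); apply: le_trans; exact: cmod_ge0.
apply: (@gronwall w k M) => // x x01.
have B1 : cmod (u1 x - f x) <= \int[mu]_(t in `[0, x]) (k t * cmod (u2 t)).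
  apply: (cmod_cprim_le pd) => //.
  - by rewrite /u1 /f /g /c !z0 v10 expr0n/= mul0r !subrr.
  - exact: rint01Mr.
  - by move=> t t01; rewrite cmodN cmodM ler_wpM2r ?cmod_ge0// q1k.
have B2 : cmod (u2 x) <= \int[mu]_(t in `[0, x]) (k t * cmod (u1 t)).
  apply: (cmod_cprim_le pu2) => //.
  - by rewrite /u2 /b /e !z0 v20 !addr0.
  - exact: rint01Mr.
  - by move=> t t01; rewrite cmodN cmodM ler_wpM2r ?cmod_ge0// q2k.
have -> : \int[mu]_(t in `[0, x]) (k t * w t) =
   \int[mu]_(t in `[0, x]) (k t * cmod (u2 t)) + \int[mu]_(t in `[0, x]) (k t * cmod (u1 t)).
  case/andP: x01 => x0 x1.
  rewrite -RintegralD//; [|exact: rint01_sub (rint01Mr Ik cu2) _ _|exact: rint01_sub (rint01Mr Ik cu1) _ _].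
  by apply: eq_Rintegral => t _; rewrite /w; ring.
have B3 : cmod (u1 x) <= M + cmod (u1 x - f x).
  have -> : cmod (u1 x) = cmod (f x + (u1 x - f x)) by rewrite addrC subrK.
  by rewrite (le_trans (cmodD _ _))// lerD2r; exact: HM.
by rewrite /w addrA lerD// (le_trans B3)// lerD2l.
Qed.

End gronwall.
(** * Translation invariance and the sheared Fubini theorem *)

Section shear.
Variable R : realType.
Notation mu := (@lebesgue_measure R).
(* The measurable type on which [lebesgue_measure] lives; it is convertible to [R]. *)
Notation T := (measurableTypeR R).
Local Open Scope ereal_scope.

Let measurable_shift (a : R) :
  measurable_fun [set: measurableTypeR R] ((fun x : R => x + a)%R : _ -> measurableTypeR R).
Proof. by apply: measurable_funD => //; exact: measurable_cst. Qed.

Lemma ge0_integral_shift (f : R -> \bar R) (a : R) :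
  measurable_fun [set: R] f -> (forall x, 0 <= f x) ->
  \int[mu]_x f (x + a)%R = \int[mu]_x f x.
Proof.
move=> mf f0.
have := @ge0_integral_pushforward _ _ _ _ R _ (measurable_shift a) mu setT f measurableT mf (fun x _ => f0 x).
rewrite preimage_setT => <-.
apply: eq_measure_integral => //= A mA _.
apply: esym; apply: lebesgue_measure_unique => //= _ [[u v]] _ <-.
rewrite /pushforward.
have -> : ((fun x : R => x + a)%R @^-1` [set` `]u, v]]) = `](u - a)%R, (v - a)%R]%classic.
  by apply/seteqP; split => x /=; rewrite !in_itv/= ltrBlDr lerBrDr.
rewrite !lebesgue_measure_itv/= !lte_fin ltrD2r.
by case: ifPn => // _; rewrite -!EFinD; congr EFin; ring.
Qed.

Lemma integral_shift (f : R -> \bar R) (a : R) : measurable_fun [set: R] f ->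
  \int[mu]_x f (x + a)%R = \int[mu]_x f x.
Proof.
move=> mf; rewrite integralE [RHS]integralE.
have mp : measurable_fun [set: R] f^\+ by exact: measurable_funepos.
have mn : measurable_fun [set: R] f^\- by exact: measurable_funeneg.
have ip := ge0_integral_shift a mp (funepos_ge0 f).
have im := ge0_integral_shift a mn (funeneg_ge0 f).
rewrite -ip -im; congr (_ - _); apply: eq_integral => x _.
- exact: (congr1 (fun h => h x) (funepos_comp f (fun x : R => x + a)%R)).
- exact: (congr1 (fun h => h x) (funeneg_comp f (fun x : R => x + a)%R)).
Qed.

Lemma integrable_shift (f : R -> \bar R) (a : R) : mu.-integrable setT f ->
  mu.-integrable setT (fun x => f (x + a)%R).
Proof.
move=> /integrableP[mf If]; apply/integrableP; split.
  exact: (measurableT_comp mf (measurable_shift a)).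
by rewrite (integral_shift a (f := fun x => `|f x|))//; exact: measurableT_comp.
Qed.

Let sh (p : T * T) : T * T := ((p.1 : R) + (p.2 : R), p.2)%R.

Let measurable_sh : measurable_fun [set: T * T] sh.
Proof.
apply/measurable_fun_pairP; split => /=.
  by apply: measurable_funD; [exact: measurable_fst|exact: measurable_snd].
exact: measurable_snd.
Qed.

(** The change of variable [(t, y) -> (t + y, y)] in an iterated integral. *)
Lemma integral_shear (G : T * T -> \bar R) : (mu \x mu).-integrable setT G ->
  (mu \x mu).-integrable setT (G \o sh) /\
  \int[mu]_t \int[mu]_y G (t + y, y)%R = \int[mu]_x \int[mu]_y G (x, y).
Proof.
move=> IG; have [mG _] := integrableP _ _ _ IG.
have mGs : measurable_fun setT (G \o sh) := measurableT_comp mG measurable_sh.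
have E : \int[mu]_y \int[mu]_t `|(G \o sh) (t, y)| = \int[mu]_y \int[mu]_t `|G (t, y)|.
  apply: eq_integral => y _; apply: (integral_shift y (f := fun t => `|G (t, y)|)).
  apply: measurableT_comp => //; exact: (measurable_fun_pair1 y mG).
have IGs : (mu \x mu).-integrable setT (G \o sh).
  apply/(integrable21ltyP mu mu mGs); rewrite E.
  exact: (integrable21ltyP mu mu mG).1 IG.
split; first exact: IGs.
rewrite (Fubini IG) -[LHS]/(\int[mu]_t \int[mu]_y (G \o sh) (t, y)) (Fubini IGs).
apply: eq_integral => y _; apply: (integral_shift y (f := fun t => G (t, y))).
exact: (measurable_fun_pair1 y mG).
Qed.

(** Iterated real-valued integrals, whose inner integral may diverge on a null
    set, agree with the iterated extended-real-valued ones. *)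
Lemma Rintegral2E (g : T * T -> R) : (mu \x mu).-integrable setT (EFin \o g) ->
  (\int[mu]_x \int[mu]_y g (x, y))%R = fine (\int[mu]_x \int[mu]_y (g (x, y))%:E).
Proof.
move=> Ig; rewrite /Rintegral; congr fine.
have mF := measurable_fubini_F Ig.
apply: ae_eq_integral => //.
- by apply/measurable_EFinP; apply: measurableT_comp mF; exact: fine_measurable.
- have F : Filter (almost_everywhere mu) by exact: (ae_filter_ringOfSetsType mu).
  apply: (@filterS _ _ F _ _ _ (ae_integrable1 Ig)) => x Ix _.
  by rewrite fineK//; apply: integrable_fin_num.
Qed.

Lemma Rintegral_shear (g : T * T -> R) : (mu \x mu).-integrable setT (EFin \o g) ->
  (\int[mu]_t \int[mu]_y g (t + y, y) = \int[mu]_x \int[mu]_y g (x, y))%R.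
Proof.
move=> Ig; have [Igs E] := integral_shear Ig.
by rewrite (Rintegral2E Ig) -[LHS]/(\int[mu]_t \int[mu]_y (g \o sh) (t, y))%R (Rintegral2E Igs) -E.
Qed.

End shear.

(** * Complex integrals over a measure space *)

Section complex_integral.
Context (d : measure_display) (T : measurableType d) (R : realType).
Implicit Types (f g : T -> R[i]) (D : set T).

(** Measurability of a complex function, on real and imaginary parts. *)
Definition cmeasurable f : Prop :=
  measurable_fun setT (fun x => complex.Re (f x)) /\
  measurable_fun setT (fun x => complex.Im (f x)).

Lemma cmeasurable_cst (c : R[i]) : cmeasurable (fun=> c).
Proof. by split; exact: measurable_cst. Qed.

Lemma cmeasurableD f g : cmeasurable f -> cmeasurable g ->
  cmeasurable (fun x => f x + g x).
Proof.
move=> [fR fI] [gR gI]; split.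
- have -> : (fun x => complex.Re (f x + g x)) = (fun x => complex.Re (f x) + complex.Re (g x)).
    by apply/funext => x; rewrite ReD.
  exact: measurable_funD.
- have -> : (fun x => complex.Im (f x + g x)) = (fun x => complex.Im (f x) + complex.Im (g x)).
    by apply/funext => x; rewrite ImD.
  exact: measurable_funD.
Qed.

Lemma cmeasurableM f g : cmeasurable f -> cmeasurable g ->
  cmeasurable (fun x => f x * g x).
Proof.
move=> [fR fI] [gR gI]; split.
- have -> : (fun x => complex.Re (f x * g x)) =
      (fun x => complex.Re (f x) * complex.Re (g x) - complex.Im (f x) * complex.Im (g x)).
    by apply/funext => x; rewrite ReM.
  by apply: measurable_funB; exact: measurable_funM.
- have -> : (fun x => complex.Im (f x * g x)) =
      (fun x => complex.Re (f x) * complex.Im (g x) + complex.Im (f x) * complex.Re (g x)).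
    by apply/funext => x; rewrite ImM.
  by apply: measurable_funD; exact: measurable_funM.
Qed.

Lemma cmeasurable_cexp f : cmeasurable f -> cmeasurable (fun x => cexp (f x)).
Proof.
move=> [fR fI].
have mc : measurable_fun setT (@cos R) by apply: continuous_measurable_fun; exact: continuous_cos.
have ms : measurable_fun setT (@sin R) by apply: continuous_measurable_fun; exact: continuous_sin.
have me : measurable_fun setT (@expR R) by exact: measurable_expR.
split => /=.
- by apply: measurable_funM; [exact: (measurableT_comp me fR)|exact: (measurableT_comp mc fI)].
- by apply: measurable_funM; [exact: (measurableT_comp me fR)|exact: (measurableT_comp ms fI)].
Qed.

Lemma cmeasurable_real (f : T -> R) : measurable_fun setT f -> cmeasurable (fun x => (f x)%:C).
Proof. by move=> mf; split => //=; exact: measurable_cst. Qed.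

Lemma cmeasurable_if (P : T -> bool) f : measurable_fun setT P -> cmeasurable f ->
  cmeasurable (fun x => if P x then f x else 0).
Proof.
move=> mP [fR fI]; split.
- have -> : (fun x => complex.Re (if P x then f x else 0)) =
      (fun x => if P x then complex.Re (f x) else 0).
    by apply/funext => x; case: (P x).
  by apply: measurable_fun_ifT => //; exact: measurable_cst.
- have -> : (fun x => complex.Im (if P x then f x else 0)) =
      (fun x => if P x then complex.Im (f x) else 0).
    by apply/funext => x; case: (P x).
  by apply: measurable_fun_ifT => //; exact: measurable_cst.
Qed.

Variable nu : {measure set T -> \bar R}.

(** Integrability of a complex function, on real and imaginary parts. *)
Definition cintegrable D f : Prop :=
  nu.-integrable D (EFin \o (fun x => complex.Re (f x))) /\
  nu.-integrable D (EFin \o (fun x => complex.Im (f x))).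

(** The integral of a complex function, taken on real and imaginary parts. *)
Definition cint D f : R[i] :=
  (\int[nu]_(x in D) complex.Re (f x)) +i* (\int[nu]_(x in D) complex.Im (f x)).

Lemma cintZ D f (c : R[i]) : measurable D -> cintegrable D f ->
  cint D (fun x => c * f x) = c * cint D f.
Proof.
move=> mD [fR fI].
have I (a : R) (h : T -> R) : nu.-integrable D (EFin \o h) ->
    nu.-integrable D (EFin \o (fun x => a * h x)) by move=> Ih; exact: (integrableZl mD a Ih).
apply: complex_eqP; rewrite /cint ?ReM ?ImM /=.
- rewrite -!RintegralZl//.
  under eq_Rintegral do rewrite ReM.
  by rewrite RintegralB//; exact: I.
- rewrite -!RintegralZl//.
  under eq_Rintegral do rewrite ImM.
  by rewrite RintegralD//; exact: I.
Qed.

Lemma eq_cint D f g : (forall x, D x -> f x = g x) -> cint D f = cint D g.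
Proof.
by move=> fg; apply: complex_eqP; rewrite /cint /=; apply: eq_Rintegral => x /[!inE] Dx; rewrite fg.
Qed.

Lemma cint_mkcond D (P : T -> bool) f : (forall x, P x <-> D x) ->
  cint D f = cint setT (fun x => if P x then f x else 0).
Proof.
move=> PD; apply: complex_eqP; rewrite /cint /= Rintegral_mkcond; apply: eq_Rintegral => x _;
  rewrite patchE; case: ifPn; rewrite ?(inE, notin_setE).
- by move=> /PD ->.
- by case: ifPn => // /PD.
- by move=> /PD ->.
- by case: ifPn => // /PD.
Qed.

Lemma cintegrable_dom D f (w : T -> R) : measurable D -> cmeasurable f ->
  nu.-integrable D (EFin \o w) -> (forall x, D x -> cmod (f x) <= w x) -> cintegrable D f.
Proof.
move=> mD [mR mI] Iw fw; split; apply: (le_integrable mD _ _ Iw).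
- by apply/measurable_EFinP; exact: measurable_funTS mR.
- move=> x Dx /=; rewrite lee_fin (le_trans (Re_le_cmod _))//.
  by rewrite (le_trans (fw _ Dx))// ler_norm.
- by apply/measurable_EFinP; exact: measurable_funTS mI.
- move=> x Dx /=; rewrite lee_fin (le_trans (Im_le_cmod _))//.
  by rewrite (le_trans (fw _ Dx))// ler_norm.
Qed.

Lemma cmod_cint_le D f (w : T -> R) : measurable D -> cintegrable D f ->
  nu.-integrable D (EFin \o w) -> (forall x, D x -> cmod (f x) <= w x) ->
  cmod (cint D f) <= \int[nu]_(x in D) w x.
Proof.
move=> mD [fR fI] Iw fw; rewrite cmodE /=; apply: sqrt_Rintegral_le => // x Dx.
by rewrite -cmodE; exact: fw.
Qed.

End complex_integral.

(** Measurability of a parametrised integral, with no integrability required. *)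
Lemma measurable_fun_Rintegral2 (d1 d2 : measure_display) (T1 : measurableType d1)
    (T2 : measurableType d2) (R : realType) (nu : {sigma_finite_measure set T2 -> \bar R})
    (f : T1 * T2 -> R) : measurable_fun setT f ->
  measurable_fun setT (fun x => \int[nu]_y f (x, y)).
Proof.
move=> mf; rewrite /Rintegral.
apply: (measurableT_comp (fine_measurable measurableT)).
have mE : measurable_fun setT (EFin \o f) by exact/measurable_EFinP.
have -> : (fun x => (\int[nu]_y (f (x, y))%:E)%E) =
   (fun x => (\int[nu]_y (EFin \o f)^\+ (x, y) - \int[nu]_y (EFin \o f)^\- (x, y))%E).
  apply/funext => x; rewrite integralE.
  under eq_integral do rewrite (funepos_comp (EFin \o f) (pair x))/=.
  by under [X in (_ - X)%E]eq_integral do rewrite (funeneg_comp (EFin \o f) (pair x))/=.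
apply: emeasurable_funB.
- exact: (measurable_fun_fubini_tonelli_F (m2 := nu) _ (measurable_funepos mE) (funepos_ge0 _)).
- exact: (measurable_fun_fubini_tonelli_F (m2 := nu) _ (measurable_funeneg mE) (funeneg_ge0 _)).
Qed.

Lemma cmeasurable_cint2 (d1 d2 : measure_display) (T1 : measurableType d1)
    (T2 : measurableType d2) (R : realType) (nu : {sigma_finite_measure set T2 -> \bar R})
    (f : T1 * T2 -> R[i]) : cmeasurable f ->
  cmeasurable (fun x => cint nu setT (fun y => f (x, y))).
Proof.
move=> [fR fI]; split => /=.
- exact: (measurable_fun_Rintegral2 nu fR).
- exact: (measurable_fun_Rintegral2 nu fI).
Qed.

(** * Twisted convolutions over a triangle *)

Section shear_complex.
Variable R : realType.
Notation mu := (@lebesgue_measure R).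
Notation T := (measurableTypeR R).

Lemma cintegralE (a b : R) (f : R -> R[i]) : cintegral a b f = cint mu `[a, b] f.
Proof. by []. Qed.

Lemma cint_shear (G : T * T -> R[i]) : cintegrable (mu \x mu)%E setT G ->
  cint mu setT (fun t : T => cint mu setT (fun y : T => G ((t : R) + (y : R), y))) =
  cint mu setT (fun x => cint mu setT (fun y => G (x, y))).
Proof.
move=> [GR GI]; apply: complex_eqP; rewrite /cint /=.
- exact: (Rintegral_shear GR).
- exact: (Rintegral_shear GI).
Qed.

Lemma integrable_tensor (a b : T -> R) : mu.-integrable setT (EFin \o a) ->
  mu.-integrable setT (EFin \o b) ->
  (mu \x mu)%E.-integrable setT (EFin \o (fun p : T * T => a p.1 * b p.2)).
Proof.
move=> Ia Ib.
have [/measurable_EFinP ma _] := integrableP _ _ _ Ia.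
have [/measurable_EFinP mb _] := integrableP _ _ _ Ib.
have mab : measurable_fun setT (EFin \o (fun p : T * T => a p.1 * b p.2)).
  apply/measurable_EFinP; apply: measurable_funM.
    exact: (measurableT_comp ma measurable_fst).
  exact: (measurableT_comp mb measurable_snd).
apply/(integrable12ltyP mu mu mab) => /=.
have Ina := integrable_norm Ia; have Inb := integrable_norm Ib.
pose B := \int[mu]_y `|b y|.
have E x : (\int[mu]_y `|a x * b y|%:E = (B * `|a x|)%:E)%E.
  under eq_integral do rewrite normrM EFinM.
  rewrite integralZl// mulrC EFinM; congr (_ * _)%E.
  by rewrite /B /Rintegral fineK//; apply: integrable_fin_num.
under eq_integral do rewrite E.
have IB := integrableZl measurableT B Ina.
have := integrable_fin_num measurableT IB; rewrite ge0_fin_numE//.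
apply: integral_ge0 => y _; rewrite /= -EFinM lee_fin mulr_ge0//.
by apply: Rintegral_ge0 => z _.
Qed.

Lemma integrable_itv (w : T -> \bar R) (a b : R) : mu.-integrable setT w ->
  mu.-integrable `[a, b] w.
Proof. by move=> Iw; apply: integrableS Iw. Qed.

Lemma cint0 (D : set T) : cint mu D (fun=> 0) = 0.
Proof.
by rewrite /cint /= /Rintegral integral0.
Qed.

(** Exchange of the order of integration in a twisted convolution, after the
    change of variable [(t, y) -> (t + y, y)].  The square-integrability hypotheses make every
    inner integral converge, not only almost all of them. *)
Lemma cintegral_shear (s : T -> R[i]) (F : T * T -> R[i]) (f : T -> R) (kap lam : R[i]) (x : R) :
  0 <= x <= 1 -> cmeasurable s -> cmeasurable F ->
  mu.-integrable setT (EFin \o (fun t => cmod (s t))) ->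
  mu.-integrable setT (EFin \o (fun t => cmod (s t) ^+ 2)) ->
  mu.-integrable setT (EFin \o f) ->
  mu.-integrable setT (EFin \o (fun t => f t ^+ 2)) ->
  (forall y, 0 <= f y) ->
  (forall t y : R, 0 <= y -> y <= t -> t <= 1 -> cmod (F (t, y)) <= f y) ->
  cintegral 0 x (fun t => cexp (kap + - lam * t%:C) *
    cintegral 0 (x - t) (fun y => s (t + y) * F (t + y, y))) =
  cintegral 0 x (fun t => cexp (kap + - lam * t%:C) * s t *
    cintegral 0 t (fun y => cexp (lam * y%:C) * F (t, y))).
Proof.
move=> /andP[x0 x1] ms mF Is Is2 If If2 f0 Ff.
(* The integrand over the triangle [0 <= y <= t <= x], extended by zero. *)
pose P (p : T * T) := [&& 0 <= (p.2 : R), (p.2 : R) <= (p.1 : R) & (p.1 : R) <= x].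
pose G (p : T * T) : R[i] :=
  if P p then cexp (kap + - lam * ((p.1 : R) - (p.2 : R))%:C) * (s p.1 * F p) else 0.
have mP : measurable_fun setT P.
  have m1 : measurable_fun [set: T * T] (fun p : T * T => p.1 : R) := measurable_fst.
  have m2 : measurable_fun [set: T * T] (fun p : T * T => p.2 : R) := measurable_snd.
  apply: measurable_and; first by apply: measurable_fun_ler => //; exact: measurable_cst.
  by apply: measurable_and; apply: measurable_fun_ler => //; exact: measurable_cst.
have ms1 : cmeasurable (fun p : T * T => s p.1).
  by case: ms => mR mI; split; [exact: (measurableT_comp mR measurable_fst)|exact: (measurableT_comp mI measurable_fst)].
have mG : cmeasurable G.
  apply: cmeasurable_if => //; apply: cmeasurableM; last exact: cmeasurableM.
  apply: cmeasurable_cexp; apply: cmeasurableD; first exact: cmeasurable_cst.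
  apply: cmeasurableM; first exact: cmeasurable_cst.
  apply: cmeasurable_real; apply: measurable_funB; [exact: measurable_fst|exact: measurable_snd].
pose C' := expR `|complex.Re lam|; pose C := expR (complex.Re kap) * C'.
have eC r : 0 <= r <= 1 -> cmod (cexp (kap + - lam * r%:C)) <= C.
  move=> /andP[r0 r1]; rewrite cexpD cmodM !cmod_cexp ler_wpM2l ?expR_ge0// ler_expR.
  rewrite ReM /= mulr0 subr0 ReN.
  by rewrite (le_trans (ler_norm _))// normrM normrN (ger0_norm r0) ler_piMr.
have IG : cintegrable (mu \x mu)%E setT G.
  have It := integrableZl measurableT C (integrable_tensor Is If).
  apply: (cintegrable_dom measurableT mG It) => p _ /=.
  have Is0 := cmod_ge0 (s p.1).
  rewrite /G; case: ifPn => [/and3P[p0 p12 p1]|_]; last first.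
    by rewrite cmod0 !mulr_ge0// ?expR_ge0// mulr_ge0 ?expR_ge0.
  rewrite !cmodM ler_pM ?mulr_ge0 ?cmod_ge0//; first by apply: eC; lra.
  rewrite ler_wpM2l//; case: p p0 p12 p1 {Is0} => a b /= p0 p12 p1; apply: Ff => //.
  exact: le_trans x1.
have mRR (D : set R) : measurable D -> measurable (D : set T) by [].
transitivity (cint mu setT (fun t : T => cint mu setT (fun y : T => G ((t : R) + (y : R), y)))).
  rewrite cintegralE (@cint_mkcond _ _ _ mu _ (fun t : T => 0 <= (t : R) <= x)); last first.
    by move=> t; rewrite /= in_itv.
  apply: eq_cint => t _; case: ifPn => [/andP[t0 tx]|tx]; last first.
    rewrite -(cint0 setT); apply: eq_cint => y _; rewrite /G ifF//.
    apply: contraNF tx; rewrite /P/= => /and3P[y0 yty tyx].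
    by apply/andP; split; lra.
  rewrite cintegralE -cintZ//; last first.
    have Is2t := integrable_shift t Is2.
    have Iw := integrableD measurableT Is2t If2.
    have Iw' : mu.-integrable `[0, x - t]
        (EFin \o (fun y : T => cmod (s ((y : R) + t)) ^+ 2 + f y ^+ 2)).
      exact: integrable_itv Iw.
    apply: (cintegrable_dom _ _ Iw') => //.
      have mt : measurable_fun [set: T] (fun y : T => (t : R) + (y : R)).
        by apply: measurable_funD => //; exact: measurable_cst.
      have mty : measurable_fun [set: T] (fun y : T => (((t : R) + (y : R)) : T, y)).
        by apply: measurable_fun_pair.
      case: ms => mR mI; case: mF => mFR mFI.
      apply: cmeasurableM; split.
      - exact: (measurableT_comp mR mt).
      - exact: (measurableT_comp mI mt).
      - exact: (measurableT_comp mFR mty).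
      - exact: (measurableT_comp mFI mty).
    move=> y /=; rewrite in_itv/= => /andP[y0 yx].
    have := Ff (t + y) y y0; rewrite lerDr => /(_ t0) Fty.
    have {}Fty : cmod (F (t + y, y)) <= f y by apply: Fty; lra.
    rewrite cmodM addrC [y + t]addrC.
    have := cmod_ge0 (s (t + y)); have := cmod_ge0 (F (t + y, y)).
    set A := cmod (s _); set B := cmod (F _) in Fty *.
    (* [A (f y) <= A^2 + (f y)^2] *)
    have := sqr_ge0 (A - f y); rewrite sqrrB => AB B0 A0.
    apply: (@le_trans _ _ (A * f y)); first by rewrite ler_wpM2l.
    by have := sqr_ge0 A; have := sqr_ge0 (f y); rewrite mulr2n in AB; lra.
  rewrite (@cint_mkcond _ _ _ mu _ (fun y : T => 0 <= (y : R) <= x - t)); last first.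
    by move=> y; rewrite /= in_itv.
  apply: eq_cint => y _; rewrite /G /P/= addrK lerDr t0/= lerBrDl.
  by case: ifPn.
rewrite (cint_shear IG) cintegralE [RHS](@cint_mkcond _ _ _ mu _ (fun t : T => 0 <= (t : R) <= x)); last first.
  by move=> t; rewrite /= in_itv.
apply: eq_cint => t _; case: ifPn => [/andP[t0 tx]|tx]; last first.
  apply: etrans (cint0 setT); apply: eq_cint => y _; rewrite /G ifF//.
  apply: contraNF tx; rewrite /P/= => /and3P[y0 yt tx].
  by apply/andP; split; lra.
rewrite cintegralE -cintZ//; last first.
  have If' := integrableZl measurableT C' If.
  have Iw' : mu.-integrable `[0, t] (EFin \o (fun y : T => C' * f y)).
    exact: integrable_itv If'.
  apply: (cintegrable_dom _ _ Iw') => //.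
    apply: cmeasurableM.
      apply: cmeasurable_cexp; apply: cmeasurableM; first exact: cmeasurable_cst.
      by apply: cmeasurable_real.
    case: mF => mFR mFI; split.
    - exact: (measurable_fun_pair2 t mFR).
    - exact: (measurable_fun_pair2 t mFI).
  move=> y /=; rewrite in_itv/= => /andP[y0 yt].
  rewrite cmodM ler_pM ?cmod_ge0//; last by apply: Ff => //; lra.
  rewrite cmod_cexp ler_expR ReM /= mulr0 subr0.
  by rewrite (le_trans (ler_norm _))// normrM (ger0_norm y0) ler_piMr//; lra.
rewrite [RHS](@cint_mkcond _ _ _ mu _ (fun y : T => 0 <= (y : R) <= t)); last first.
  by move=> y; rewrite /= in_itv.
apply: eq_cint => y _; rewrite /G /P/= tx andbT; case: ifPn => // _.
have -> : kap + - lam * (t - y)%:C = (kap + - lam * t%:C) + lam * y%:C.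
  by rewrite rmorphB/=; ring.
by rewrite [in LHS]cexpD; ring.
Qed.

End shear_complex.
(** * Lebesgue norms and the forcing term *)

Section norms.
Variable R : realType.
Notation mu := (@lebesgue_measure R).
Notation T := (measurableTypeR R).
Implicit Types (s f b : R -> R[i]).

Lemma Lpnorm01E (p : R) s :
  Lpnorm01 p s = ('N[mu]_p%:E[EFin \o ((fun x : R => cmod (s x)) \_ `[0%R, 1%R])])%E.
Proof. by rewrite /Lpnorm01 -restrict_EFin. Qed.

Lemma measurable_cmod_restrict s :
  measurable_fun (`[0, 1] : set R) (fun x => complex.Re (s x)) ->
  measurable_fun (`[0, 1] : set R) (fun x => complex.Im (s x)) ->
  measurable_fun (setT : set R) ((fun x => cmod (s x)) \_ `[0, 1]).
Proof.
move=> mR mI; apply/(measurable_restrictT _ _).1 => //.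
exact: measurable_cmod.
Qed.

Lemma Lpnorm01_2E s : (Lpnorm01 2 s `^ 2 = \int[mu]_(x in `[0%R, 1%R]) (cmod (s x) ^+ 2)%:E)%E.
Proof.
rewrite Lpnorm01E poweR_Lnorm//.
rewrite [RHS]integral_mkcond; apply: eq_integral => x _ /=.
rewrite !patchE; case: ifPn => _.
  by rewrite ger0_norm ?cmod_ge0// powR_mulrn// cmod_ge0.
by rewrite normr0 powR0.
Qed.

Lemma in_L2_rint01 s : in_Lp01 2 s -> rint01 (fun x => cmod (s x) ^+ 2).
Proof.
move=> [mR mI sfin]; apply/integrableP; split.
  apply/measurable_EFinP; apply: measurable_funX.
  exact: measurable_cmod.
under eq_integral do rewrite /= ger0_norm ?sqr_ge0//.
by rewrite -Lpnorm01_2E poweR_lty.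
Qed.

Lemma normL_ge0 (p : R) s : 0 <= normL p s.
Proof. by rewrite fine_ge0// Lnorm_ge0. Qed.

Lemma rint01_cst (c : R) : rint01 (fun=> c).
Proof. by apply: rint01_cont; apply: continuous_subspaceT; exact: cst_continuous. Qed.

Lemma in_L2_cint01 s : in_Lp01 2 s -> cint01 s.
Proof.
move=> Hs; have [mR mI _] := Hs; apply: rint01_cmodK => //.
have I := rint01D (rint01_cst 1) (in_L2_rint01 Hs).
apply: (rint01_dom _ I); first exact: measurable_cmod.
move=> x _; rewrite ger0_norm ?cmod_ge0//.
by have := sqr_ge0 (cmod (s x) - 1); have := sqr_ge0 (cmod (s x)); rewrite sqrrB1 mulr2n; lra.
Qed.

Lemma normL1E s : normL 1 s = \int[mu]_(x in `[0, 1]) cmod (s x).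
Proof.
rewrite /normL Lpnorm01E Lnorm1 /Rintegral; congr fine.
rewrite [RHS]integral_mkcond; apply: eq_integral => x _ /=.
by rewrite !patchE; case: ifPn => _; rewrite ?normr0// ger0_norm ?cmod_ge0.
Qed.

Lemma in_C01M f b : in_C01 f -> in_C01 b -> in_C01 (fun x => f x * b x).
Proof.
move=> [fR fI] [bR bI]; split.
- have -> : (fun x => complex.Re (f x * b x)) =
      (fun x => complex.Re (f x) * complex.Re (b x) - complex.Im (f x) * complex.Im (b x)).
    by apply/funext => x; rewrite ReM.
  exact: within_contB (within_contM fR bR) (within_contM fI bI).
- have -> : (fun x => complex.Im (f x * b x)) =
      (fun x => complex.Re (f x) * complex.Im (b x) + complex.Im (f x) * complex.Re (b x)).
    by apply/funext => x; rewrite ImM.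
  exact: within_contD (within_contM fR bI) (within_contM fI bR).
Qed.

Lemma in_C01_L2 b : in_C01 b -> in_Lp01 2 b.
Proof.
move=> cb; have [cR cI] := cb; split.
- exact: subspace_continuous_measurable_fun.
- exact: subspace_continuous_measurable_fun.
- have cm := cmod_cont cb.
  have I : rint01 (fun x => cmod (b x) ^+ 2).
    by have := rint01M cm (rint01_cont cm); congr rint01; apply/funext => x; rewrite expr2.
  have : (Lpnorm01 2 b `^ 2 < +oo)%E.
    rewrite Lpnorm01_2E; case/integrableP: I => _.
    by under eq_integral do rewrite /= ger0_norm ?sqr_ge0//.
  by move=> /(poweR_lty 2^-1); rewrite -poweRrM mulfV// poweRe1// Lnorm_ge0.
Qed.

Lemma cauchy_schwarz01 s b : in_Lp01 2 s -> in_Lp01 2 b ->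
  \int[mu]_(x in `[0, 1]) (cmod (s x) * cmod (b x)) <= normL 2 s * normL 2 b.
Proof.
move=> [sR sI sfin] [bR bI bfin].
have ms := measurable_cmod_restrict sR sI; have mb := measurable_cmod_restrict bR bI.
have := @hoelder _ T R mu _ _ 2 2 ms mb ltac:(by []) ltac:(by []) _.
have -> : (2^-1 + 2^-1 : R) = 1 by lra.
move=> /(_ erefl); rewrite Lnorm1 -!Lpnorm01E.
have -> : (\int[mu]_x `|((EFin \o ((fun x : R => cmod (s x)) \_ `[0%R, 1%R] \* (fun x : R => cmod (b x)) \_ `[0%R, 1%R])%R) x)| =
    \int[mu]_(x in `[0%R, 1%R]) (cmod (s x) * cmod (b x))%:E)%E.
  rewrite [RHS]integral_mkcond; apply: eq_integral => x _ /=.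
  rewrite !patchE; case: ifPn => _; last by rewrite mulr0 normr0.
  by rewrite ger0_norm ?mulr_ge0 ?cmod_ge0.
move=> H; rewrite -lee_fin /Rintegral fineK; last first.
  rewrite ge0_fin_numE; last by apply: integral_ge0 => x _; rewrite lee_fin mulr_ge0 ?cmod_ge0.
  by apply: (le_lt_trans H); rewrite lte_mul_pinfty ?Lnorm_ge0// ge0_fin_numE ?Lnorm_ge0.
apply: (le_trans H).
by rewrite EFinM /normL !fineK// ge0_fin_numE ?Lnorm_ge0.
Qed.

(** The bound of the forcing term of [column_remainder]: Cauchy-Schwarz for
    [c], and the weighted integral of [|b|^2] for the other term. *)
Lemma forcing_bound (E g1 g : R) s q1 b (G : R -> R) :
  0 <= E -> in_Lp01 2 s -> cint01 q1 -> in_C01 b -> rint01 G ->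
  (forall t, 0 <= t <= 1 -> cmod (q1 t) <= E * cmod (s t)) ->
  (forall t, 0 <= t <= 1 -> cmod (s t) * cmod (b t) ^+ 2 <= G t) ->
  \int[mu]_(t in `[0, 1]) G t = g1 -> normL 2 b <= g ->
  let c x := cintegral 0 x (fun t => q1 t * b t) in
  let h x := cintegral 0 x (fun t => q1 t * b t ^+ 2) in
  forall x, 0 <= x <= 1 ->
  cmod (c x ^+ 2 / 2 - cintegral 0 x (fun t => q1 t * h t)) <=
  E ^+ 2 * (normL 2 s ^+ 2 * g ^+ 2 / 2 + normL 1 s * g1).
Proof.
move=> E0 Ls Iq Cb IG qs sG Gg1 bg c h.
have Is := cint01_cmod (in_L2_cint01 Ls).
have cb := cmod_cont Cb.
have x11 : 0 <= (1 : R) <= 1 by rewrite ler01 lexx.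
have c_bound x : 0 <= x <= 1 -> cmod (c x) <= E * (normL 2 s * g).
  move=> x01.
  have Iw : rint01 (fun t => E * (cmod (s t) * cmod (b t))).
    by apply: rint01Z; exact: rint01Mr.
  apply: (@le_trans _ _ (\int[mu]_(t in `[0, x]) (E * (cmod (s t) * cmod (b t))))).
    apply: cmod_cintegral_le => //; first exact: cint01Mr.
    by move=> t t01; rewrite cmodM mulrA ler_wpM2r ?cmod_ge0// qs.
  apply: (@le_trans _ _ (\int[mu]_(t in `[0, 1]) (E * (cmod (s t) * cmod (b t))))).
    case/andP: x01 => x0 x1; apply: Rintegral01_mono => // t t01.
    by rewrite !mulr_ge0 ?cmod_ge0.
  rewrite RintegralZl//; last exact: rint01Mr.
  rewrite ler_wpM2l// (le_trans (cauchy_schwarz01 Ls (in_C01_L2 Cb)))//.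
  by rewrite ler_wpM2l ?normL_ge0.
have Cb2 : in_C01 (fun t => b t ^+ 2) by exact: in_C01M.
have Ih : cint01 (fun t => q1 t * b t ^+ 2) by exact: cint01Mr.
have ph := cprim_cintegral Ih.
have G0 t : 0 <= t <= 1 -> 0 <= G t.
  by move=> t01; apply: le_trans (sG _ t01); rewrite mulr_ge0 ?cmod_ge0 ?sqr_ge0.
have h_bound x : 0 <= x <= 1 -> cmod (h x) <= E * g1.
  move=> x01; have IEG := rint01Z E IG.
  apply: (@le_trans _ _ (\int[mu]_(t in `[0, x]) (E * G t))).
    apply: cmod_cintegral_le => // t t01; rewrite cmodM cmodX.
    apply: (@le_trans _ _ (E * cmod (s t) * cmod (b t) ^+ 2)).
      by rewrite ler_wpM2r ?sqr_ge0 ?qs.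
    by rewrite -mulrA ler_wpM2l ?sG.
  rewrite -Gg1 -RintegralZl//.
  by case/andP: x01 => x0 x1; apply: Rintegral01_mono => // t t01; rewrite mulr_ge0 ?G0.
have g1_ge0 : 0 <= g1.
  by rewrite -Gg1; apply: Rintegral_ge0 => t /=; rewrite in_itv/= => /G0.
move=> x x01.
have B1 : cmod (c x ^+ 2 / 2) <= E ^+ 2 * (normL 2 s ^+ 2 * g ^+ 2 / 2).
  have -> : (2 : R[i])^-1 = (2^-1 : R)%:C by rewrite fmorphV rmorph_nat.
  rewrite cmodM cmodX cmod_real ger0_norm ?invr_ge0//.
  have -> : E ^+ 2 * (normL 2 s ^+ 2 * g ^+ 2 / 2) = (E * (normL 2 s * g)) ^+ 2 / 2.
    by rewrite !exprMn; ring.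
  rewrite ler_wpM2r ?invr_ge0// ler_pXn2r ?nnegrE ?cmod_ge0 ?c_bound//.
  rewrite !mulr_ge0 ?normL_ge0//; apply: le_trans bg; exact: normL_ge0.
have B2 : cmod (cintegral 0 x (fun t => q1 t * h t)) <= E ^+ 2 * (normL 1 s * g1).
  pose K := E * g1 * E.
  have K0 : 0 <= K by rewrite !mulr_ge0.
  apply: (@le_trans _ _ (\int[mu]_(t in `[0, x]) (K * cmod (s t)))).
    apply: cmod_cintegral_le => //.
    - by apply: cint01Mr => //; exact: cprim_cont ph.
    - exact: rint01Z.
    - move=> t t01; rewrite cmodM mulrC /K -mulrA.
      by rewrite ler_pM ?cmod_ge0 ?h_bound ?qs.
  apply: (@le_trans _ _ (\int[mu]_(t in `[0, 1]) (K * cmod (s t)))).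
    case/andP: x01 => x0 x1; apply: Rintegral01_mono => //; first exact: rint01Z.
    by move=> t _; rewrite mulr_ge0 ?cmod_ge0.
  rewrite RintegralZl// normL1E /K.
  by rewrite le_eqVlt; apply/orP; left; apply/eqP; ring.
by rewrite (le_trans (cmodB _ _))// mulrDr lerD.
Qed.

End norms.
(** * The iterated kernels as iterated integrals *)

Section kernels.
Variable R : realType.
Notation mu := (@lebesgue_measure R).
Notation T := (measurableTypeR R).
Implicit Types (s : R -> R[i]).

(** Truncation to [0,1]. *)
Definition trunc01 s : T -> R[i] := fun x => if 0 <= (x : R) <= 1 then s x else 0.

Lemma trunc01E s (x : R) : 0 <= x <= 1 -> trunc01 s x = s x.
Proof. by rewrite /trunc01 => ->. Qed.

Let in01 (t x : R) : 0 <= t -> t <= x -> x <= 1 -> 0 <= t <= 1.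
Proof. by move=> t0 tx x1; rewrite t0 (le_trans tx x1). Qed.

Let in01D (x t y : R) : x <= 1 -> 0 <= t -> 0 <= y -> y <= x - t ->
  (0 <= t + y <= 1) /\ (0 <= y <= 1).
Proof. by move=> x1 t0 y0 yxt; split; apply/andP; split; lra. Qed.

Let in01_le (t y : R) : 0 <= t <= 1 -> 0 <= y -> y <= t -> 0 <= y <= 1.
Proof. by move=> /andP[t0 t1] y0 yt; rewrite y0 (le_trans yt t1). Qed.

Lemma eq_cintegral (a b : R) (f g : R -> R[i]) :
  (forall t, a <= t <= b -> f t = g t) -> cintegral a b f = cintegral a b g.
Proof.
by move=> fg; rewrite !cintegralE; apply: eq_cint => t /=; rewrite in_itv/=; exact: fg.
Qed.

Lemma trunc01_patch s (h : R[i] -> R) : h 0 = 0 ->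
  (fun x => h (trunc01 s x)) = ((fun x => h (s x)) \_ `[0, 1]).
Proof.
move=> h0; apply/funext => x; rewrite patchE /trunc01.
have -> : (x \in `[0, 1]%classic) = (0 <= x <= 1).
  by apply/idP/idP; rewrite inE/= in_itv.
by case: ifP.
Qed.

Lemma cmeasurable_trunc01 s : in_Lp01 2 s -> cmeasurable (trunc01 s).
Proof.
move=> [mR mI _]; split.
- rewrite (@trunc01_patch s (@complex.Re R))//.
  by apply/(measurable_restrictT _ _).1.
- rewrite (@trunc01_patch s (@complex.Im R))//.
  by apply/(measurable_restrictT _ _).1.
Qed.

Lemma integrable_trunc01 s : in_Lp01 2 s ->
  mu.-integrable setT (EFin \o (fun t => cmod (trunc01 s t))).
Proof.
move=> Hs; rewrite (@trunc01_patch s (@cmod R)) ?cmod0//.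
have := cint01_cmod (in_L2_cint01 Hs).
by rewrite /rint01 integrable_mkcond// restrict_EFin.
Qed.

Lemma integrable_trunc01_sqr s : in_Lp01 2 s ->
  mu.-integrable setT (EFin \o (fun t => cmod (trunc01 s t) ^+ 2)).
Proof.
move=> Hs; rewrite (@trunc01_patch s (fun z => cmod z ^+ 2)); last by rewrite cmod0 expr0n.
have := in_L2_rint01 Hs.
by rewrite /rint01 integrable_mkcond// restrict_EFin.
Qed.

(** A measurable bounded function on the plane that agrees with [tsigma s1 s2]
    on the triangle. *)
Definition tsigmaT (s1 s2 : R -> R[i]) (p : T * T) : R[i] :=
  cint mu setT (fun z : T => if 0 <= (z : R) <= (p.1 : R) - (p.2 : R)
    then trunc01 s1 ((p.2 : R) + (z : R)) * trunc01 s2 z else 0).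

Lemma tsigmaTE s1 s2 (t y : R) : 0 <= y -> y <= t -> t <= 1 ->
  tsigmaT s1 s2 (t, y) = tsigma s1 s2 t y.
Proof.
move=> y0 yt t1; rewrite /tsigmaT /tsigma cintegralE.
rewrite [RHS](@cint_mkcond _ _ _ mu _ (fun z : T => 0 <= (z : R) <= t - y)); last first.
  by move=> z; rewrite /= in_itv.
apply: eq_cint => z _ /=; case: ifPn => // /andP[z0 zt].
have [yz01 z01] := in01D t1 y0 z0 zt.
by rewrite (trunc01E _ yz01) (trunc01E _ z01).
Qed.

Lemma measurable_add2 (d : measure_display) (X : measurableType d) (u v : X -> T) :
  measurable_fun setT u -> measurable_fun setT v ->
  measurable_fun setT (fun x => ((u x : R) + (v x : R) : T)).
Proof. by move=> mu' mv; exact: (measurable_funD mu' mv). Qed.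

Lemma cmeasurable_tsigmaT s1 s2 : in_Lp01 2 s1 -> in_Lp01 2 s2 -> cmeasurable (tsigmaT s1 s2).
Proof.
move=> /cmeasurable_trunc01[m1R m1I] /cmeasurable_trunc01[m2R m2I].
pose H (q : (T * T) * T) : R[i] := if 0 <= (q.2 : R) <= (q.1.1 : R) - (q.1.2 : R)
    then trunc01 s1 ((q.1.2 : R) + (q.2 : R)) * trunc01 s2 q.2 else 0.
have mz : measurable_fun [set: (T * T) * T] (fun q : (T * T) * T => q.2 : R) := measurable_snd.
have mp : measurable_fun [set: (T * T) * T] (fun q : (T * T) * T => q.1) := measurable_fst.
have mt : measurable_fun [set: (T * T) * T] (fun q : (T * T) * T => q.1.1 : R) :=
  measurableT_comp measurable_fst mp.
have my : measurable_fun [set: (T * T) * T] (fun q : (T * T) * T => q.1.2 : R) :=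
  measurableT_comp measurable_snd mp.
apply: (@cmeasurable_cint2 _ _ _ _ R mu H).
apply: cmeasurable_if.
  apply: measurable_and; apply: measurable_fun_ler => //.
  exact: (measurable_funB mt my).
apply: cmeasurableM; split.
- exact: (measurableT_comp m1R (measurable_add2 my mz)).
- exact: (measurableT_comp m1I (measurable_add2 my mz)).
- exact: (measurableT_comp m2R mz).
- exact: (measurableT_comp m2I mz).
Qed.

Lemma tsigmaT_bounded s1 s2 : in_Lp01 2 s1 -> in_Lp01 2 s2 ->
  exists2 C : R, 0 <= C & forall p, cmod (tsigmaT s1 s2 p) <= C.
Proof.
move=> H1 H2; have I1 := integrable_trunc01_sqr H1; have I2 := integrable_trunc01_sqr H2.
have [m1R m1I] := cmeasurable_trunc01 H1; have [m2R m2I] := cmeasurable_trunc01 H2.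
pose A1 := \int[mu]_z cmod (trunc01 s1 z) ^+ 2; pose A2 := \int[mu]_z cmod (trunc01 s2 z) ^+ 2.
have A10 : 0 <= A1 by apply: Rintegral_ge0 => z _; exact: sqr_ge0.
have A20 : 0 <= A2 by apply: Rintegral_ge0 => z _; exact: sqr_ge0.
exists (A1 + A2); first exact: addr_ge0.
move=> [t y].
have I1y := integrable_shift y I1.
pose w (z : T) := cmod (trunc01 s1 ((z : R) + y)) ^+ 2 + cmod (trunc01 s2 z) ^+ 2.
have Iw : mu.-integrable setT (EFin \o w) by exact: integrableD I1y I2.
pose F (z : T) : R[i] := if 0 <= (z : R) <= (t : R) - (y : R)
    then trunc01 s1 ((y : R) + (z : R)) * trunc01 s2 z else 0.
have mF : cmeasurable F.
  apply: cmeasurable_if.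
    by apply: measurable_and; apply: measurable_fun_ler => //; exact: measurable_cst.
  have myz : measurable_fun setT (fun z : T => ((y : R) + (z : R) : T)).
    by apply: measurable_add2 => //; exact: measurable_cst.
  apply: cmeasurableM; split => //.
  - exact: (measurableT_comp m1R myz).
  - exact: (measurableT_comp m1I myz).
have Fw z : setT z -> cmod (F z) <= w z.
  move=> _; rewrite /F /w; case: ifPn => _; last by rewrite cmod0 addr_ge0 ?sqr_ge0.
  rewrite cmodM [y + z]addrC.
  set a := cmod _; set b := cmod (trunc01 s2 z).
  have := sqr_ge0 (a - b); have := sqr_ge0 a; have := sqr_ge0 b.
  by rewrite sqrrB mulr2n; lra.
have IF := cintegrable_dom measurableT mF Iw Fw.
apply: (le_trans (cmod_cint_le measurableT IF Iw Fw)).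
rewrite /w RintegralD//.
rewrite lerD2r le_eqVlt; apply/orP; left; apply/eqP.
rewrite /A1 /Rintegral; congr fine.
apply: (@integral_shift R (fun z => (cmod (trunc01 s1 z) ^+ 2)%:E) y).
by have [] := integrableP _ _ _ I1.
Qed.

(** Integrating the first iterated kernel gives the twofold iterated integral. *)
Lemma integral_tsigma s1 s2 (kap lam : R[i]) (x : R) : in_Lp01 2 s1 -> in_Lp01 2 s2 ->
  0 <= x <= 1 ->
  cintegral 0 x (fun t => cexp (kap + - lam * t%:C) * tsigma s1 s2 x t) =
  cintegral 0 x (fun t => cexp (kap + - lam * t%:C) * s1 t *
    cintegral 0 t (fun y => cexp (lam * y%:C) * s2 y)).
Proof.
move=> H1 H2 /andP[x0 x1].
have I2 := integrable_trunc01 H2; have I22 := integrable_trunc01_sqr H2.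
have := @cintegral_shear R (trunc01 s1) (fun p => trunc01 s2 p.2) (fun y => cmod (trunc01 s2 y)) kap lam x.
rewrite x0 x1 => /(_ isT (cmeasurable_trunc01 H1)).
have m2 : cmeasurable (fun p : T * T => trunc01 s2 p.2).
  have [mR mI] := cmeasurable_trunc01 H2.
  by split; [exact: (measurableT_comp mR measurable_snd)|exact: (measurableT_comp mI measurable_snd)].
move=> /(_ m2 (integrable_trunc01 H1) (integrable_trunc01_sqr H1) I2 I22).
move=> /(_ (fun _ => cmod_ge0 _) (fun _ _ _ _ _ => lexx _)) E.
transitivity (cintegral 0 x (fun t => cexp (kap + - lam * t%:C) *
    cintegral 0 (x - t) (fun y => trunc01 s1 (t + y) * trunc01 s2 y))).
  apply: eq_cintegral => t /andP[t0 tx]; congr (_ * _); apply: eq_cintegral => y /andP[y0 yxt].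
  have [ty01 y01] := in01D x1 t0 y0 yxt.
  by rewrite (trunc01E _ ty01) (trunc01E _ y01).
rewrite E; apply: eq_cintegral => t /andP[t0 tx].
have t01 := in01 t0 tx x1; rewrite (trunc01E _ t01).
congr (_ * _); apply: eq_cintegral => y /andP[y0 yt].
by rewrite /= (trunc01E _ (in01_le t01 y0 yt)).
Qed.

(** Integrating the second iterated kernel gives the threefold iterated
    integral, once [integral_tsigma] is applied to the inner integral. *)
Lemma integral_Top_tsigma s1 s2 (kap lam : R[i]) (x : R) : in_Lp01 2 s1 -> in_Lp01 2 s2 ->
  0 <= x <= 1 ->
  cintegral 0 x (fun t => cexp (kap + - lam * t%:C) * Top s2 (tsigma s1 s2) x t) =
  cintegral 0 x (fun t => cexp (kap + - lam * t%:C) * s2 t *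
    cintegral 0 t (fun y => cexp (lam * y%:C) * tsigma s1 s2 t y)).
Proof.
move=> H1 H2 /andP[x0 x1].
have [C C0 HC] := tsigmaT_bounded H1 H2.
pose f (y : T) : R := if 0 <= (y : R) <= 1 then C else 0.
have f0 y : 0 <= f y by rewrite /f; case: ifP.
have fE (c : R) : (fun y : T => if 0 <= (y : R) <= 1 then c else 0) = ((fun=> c) \_ `[0, 1]).
  apply/funext => y; rewrite patchE.
  have -> : (y \in `[0, 1]%classic) = (0 <= y <= 1) by apply/idP/idP; rewrite inE/= in_itv.
  by case: ifP.
have Ic (c : R) : mu.-integrable setT (EFin \o (fun y : T => if 0 <= (y : R) <= 1 then c else 0)).
  by rewrite fE; have := rint01_cst c; rewrite /rint01 integrable_mkcond// restrict_EFin.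
have If2 : mu.-integrable setT (EFin \o (fun y : T => f y ^+ 2)).
  have -> : (fun y : T => f y ^+ 2) = (fun y : T => if 0 <= (y : R) <= 1 then C ^+ 2 else 0).
    by apply/funext => y; rewrite /f; case: ifP => //; rewrite expr0n.
  exact: Ic.
have := @cintegral_shear R (trunc01 s2) (tsigmaT s1 s2) f kap lam x.
rewrite x0 x1 => /(_ isT (cmeasurable_trunc01 H2) (cmeasurable_tsigmaT H1 H2)).
move=> /(_ (integrable_trunc01 H2) (integrable_trunc01_sqr H2) (Ic C) If2 f0).
have Ff (t y : R) : 0 <= y -> y <= t -> t <= 1 -> cmod (tsigmaT s1 s2 (t, y)) <= f y.
  by move=> y0 yt t1; rewrite /f y0 (le_trans yt t1); exact: HC.
move=> /(_ Ff) E.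
transitivity (cintegral 0 x (fun t => cexp (kap + - lam * t%:C) *
    cintegral 0 (x - t) (fun y => trunc01 s2 (t + y) * tsigmaT s1 s2 (t + y, y)))).
  apply: eq_cintegral => t /andP[t0 tx]; congr (_ * _); apply: eq_cintegral => y /andP[y0 yxt].
  have [ty01 y01] := in01D x1 t0 y0 yxt; have [_ ty1] := andP ty01.
  have yty : y <= t + y by rewrite lerDr.
  by rewrite (trunc01E _ ty01) (tsigmaTE _ _ y0 yty ty1).
rewrite E; apply: eq_cintegral => t /andP[t0 tx].
have t01 := in01 t0 tx x1; rewrite (trunc01E _ t01).
congr (_ * _); apply: eq_cintegral => y /andP[y0 yt].
by rewrite (tsigmaTE _ _ y0 yt (le_trans tx x1)).
Qed.

End kernels.
(** * One column of the solution *)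

Lemma in_C01_eq (R : realType) (f g : R -> R[i]) : in_C01 f ->
  (forall x, 0 <= x <= 1 -> f x = g x) -> in_C01 g.
Proof.
move=> [fR fI] fg; split.
- apply: subspace_eq_continuous fR => x; rewrite inE/= in_itv/= => x01.
  by rewrite /from_subspace fg.
- apply: subspace_eq_continuous fI => x; rewrite inE/= in_itv/= => x01.
  by rewrite /from_subspace fg.
Qed.

Section column.
Variable R : realType.
Notation mu := (@lebesgue_measure R).
(* The entries [q1], [q2] of the coefficient matrix in the interaction picture
   and their iterated integrals. *)
Variables (s1 s2 : R -> R[i]) (d : R) (m : R[i]).
Hypotheses (L1 : in_Lp01 2 s1) (L2 : in_Lp01 2 s2) (md : `|complex.Im m| <= d).

Let q1 t := cexp (- 2 * 'i%C * m * t%:C) * s1 t.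
Let q2 t := cexp (2 * 'i%C * m * t%:C) * s2 t.
Let b x := cintegral 0 x q2.
Let c x := cintegral 0 x (fun t => q1 t * b t).
Let e x := cintegral 0 x (fun t => q2 t * c t).
Let E := expR (2 * d).

Let Re_im (z : R[i]) (t : R) : complex.Re ('i%C * z * t%:C) = - complex.Im z * t.
Proof. by rewrite ReM ReM ImM /=; ring. Qed.

Let cmod_cexp_im (z : R[i]) (t : R) : 0 <= t <= 1 -> `|complex.Im z| <= d ->
  cmod (cexp ('i%C * z * t%:C)) <= expR d.
Proof.
move=> /andP[t0 t1] zd; rewrite cmod_cexp ler_expR Re_im.
rewrite (le_trans (ler_norm _))// normrM normrN (ger0_norm t0).
by rewrite (le_trans _ zd)// ler_piMr.
Qed.

Let in_C01_cexp (z : R[i]) : in_C01 (fun t : R => cexp (z * t%:C)).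
Proof. exact: cprim_cont (cprim_cexp z). Qed.

Let Iq1 : cint01 q1.
Proof. by apply: cint01M; [exact: in_C01_cexp|exact: in_L2_cint01]. Qed.

Let Iq2 : cint01 q2.
Proof. by apply: cint01M; [exact: in_C01_cexp|exact: in_L2_cint01]. Qed.

Let cmod_cexp2 (z : R[i]) (t : R) : 0 <= t <= 1 -> `|complex.Im z| <= d ->
  cmod (cexp (2 * 'i%C * z * t%:C)) <= E.
Proof.
move=> t01 zd; have -> : 2 * 'i%C * z * t%:C = 'i%C * z * t%:C + 'i%C * z * t%:C by ring.
rewrite cexpD cmodM /E mulrDl mul1r expRD.
by rewrite ler_pM ?cmod_ge0 ?cmod_cexp_im.
Qed.

Let q1_le t : 0 <= t <= 1 -> cmod (q1 t) <= E * cmod (s1 t).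
Proof.
move=> t01; rewrite cmodM ler_wpM2r ?cmod_ge0//.
have -> : - 2 * 'i%C * m * t%:C = 2 * 'i%C * (- m) * t%:C by ring.
by apply: cmod_cexp2 => //; rewrite ImN normrN.
Qed.

Let q2_le t : 0 <= t <= 1 -> cmod (q2 t) <= E * cmod (s2 t).
Proof. by move=> t01; rewrite cmodM ler_wpM2r ?cmod_ge0// cmod_cexp2. Qed.

Let E0 : 0 <= E. Proof. exact: expR_ge0. Qed.

Let pb : cprim b q2 := cprim_cintegral Iq2.
Let pc : cprim c (fun t => q1 t * b t) := cprim_cintegral (cint01Mr Iq1 (cprim_cont pb)).
Let pe : cprim e (fun t => q2 t * c t) := cprim_cintegral (cint01Mr Iq2 (cprim_cont pc)).

(** The diagonal and the off-diagonal part of the first column of [D0mx]. *)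
Let P1 x := cintegral 0 x (fun t => cexp ('i%C * m * (x - 2 * t)%:C) * tsigma s1 s2 x t).
Let P2 x := - cintegral 0 x (fun t => cexp (- ('i%C * m) * (x - 2 * t)%:C) * s2 t)
  - cintegral 0 x (fun t => cexp (- ('i%C * m) * (x - 2 * t)%:C) * Top s2 (tsigma s1 s2) x t).

Let cintegralZ01 (z : R[i]) f x : cint01 f -> 0 <= x <= 1 ->
  cintegral 0 x (fun t => z * f t) = z * cintegral 0 x f.
Proof.
move=> [fR fI] /andP[x0 x1]; rewrite !cintegralE cintZ//; split.
- exact: rint01_sub fR _ _.
- exact: rint01_sub fI _ _.
Qed.
Lemma diag_kernel_integral x : 0 <= x <= 1 -> P1 x = cexp ('i%C * m * x%:C) * c x.
Proof.
move=> x01; rewrite /P1 /c -cintegralZ01//; last exact: cprim_int pc.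
have K (t : R) : 'i%C * m * (x - 2 * t)%:C = 'i%C * m * x%:C + - (2 * 'i%C * m) * t%:C.
  by rewrite rmorphB rmorphM/= rmorph_nat; ring.
transitivity (cintegral 0 x (fun t => cexp ('i%C * m * x%:C + - (2 * 'i%C * m) * t%:C) *
    tsigma s1 s2 x t)).
  by apply: eq_cintegral => t _; rewrite K.
apply: etrans (integral_tsigma _ _ L1 L2 x01) _; apply: eq_cintegral => t _.
rewrite cexpD /q1.
have -> : - (2 * 'i%C * m) * t%:C = - 2 * 'i%C * m * t%:C by ring.
by rewrite /b /q2; ring.
Qed.

Lemma offdiag_kernel_integral x : 0 <= x <= 1 ->
  P2 x = cexp (- ('i%C * m) * x%:C) * (- b x - e x).
Proof.
move=> x01; rewrite mulrDr !mulrN /P2; congr (- _ - _).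
  rewrite /b -cintegralZ01//; apply: eq_cintegral => t _.
  have -> : - ('i%C * m) * (x - 2 * t)%:C = - ('i%C * m) * x%:C + 2 * 'i%C * m * t%:C.
    by rewrite rmorphB rmorphM/= rmorph_nat; ring.
  by rewrite cexpD /q2; ring.
rewrite /e -cintegralZ01//; last exact: cprim_int pe.
have K (t : R) : - ('i%C * m) * (x - 2 * t)%:C =
    - ('i%C * m) * x%:C + - (- (2 * 'i%C * m)) * t%:C.
  by rewrite rmorphB rmorphM/= rmorph_nat; ring.
transitivity (cintegral 0 x (fun t => cexp (- ('i%C * m) * x%:C + - (- (2 * 'i%C * m)) * t%:C) *
    Top s2 (tsigma s1 s2) x t)).
  by apply: eq_cintegral => t _; rewrite K.
apply: etrans (integral_Top_tsigma _ _ L1 L2 x01) _; apply: eq_cintegral => t /andP[t0 tx].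
have t01 : 0 <= t <= 1 by rewrite t0 (le_trans tx)//; case/andP: x01.
have -> : cintegral 0 t (fun y => cexp (- (2 * 'i%C * m) * y%:C) * tsigma s1 s2 t y) = c t.
  transitivity (cintegral 0 t (fun y => cexp (0 + - (2 * 'i%C * m) * y%:C) * tsigma s1 s2 t y)).
    by apply: eq_cintegral => y _; rewrite add0r.
  apply: etrans (integral_tsigma _ _ L1 L2 t01) _; apply: eq_cintegral => y _.
  rewrite add0r /q1.
  have -> : - (2 * 'i%C * m) * y%:C = - 2 * 'i%C * m * y%:C by ring.
  by [].
rewrite cexpD /q2.
have -> : - (- (2 * 'i%C * m)) * t%:C = 2 * 'i%C * m * t%:C by ring.
ring.
Qed.

Variables (y1 y2 : R -> R[i]).
Hypotheses (py1 : cprim y1 (fun t => 'i%C * m * y1 t - s1 t * y2 t))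
  (py2 : cprim y2 (fun t => - ('i%C * m) * y2 t - s2 t * y1 t))
  (y10 : y1 0 = 1) (y20 : y2 0 = 0).

(* The column [(y1, y2)] of the solution in the interaction picture. *)
Let v1 t := cexp (- ('i%C * m) * t%:C) * y1 t.
Let v2 t := cexp ('i%C * m * t%:C) * y2 t.

Let pv1 : cprim v1 (fun t => - (q1 t * v2 t)).
Proof.
apply: cprim_ext (cprimM (cprim_cexp (- ('i%C * m))) py1) _ _ => // t.
rewrite /q1 /v2.
have -> : - 2 * 'i%C * m * t%:C = - ('i%C * m) * t%:C + - ('i%C * m) * t%:C by ring.
have H : cexp (- ('i%C * m) * t%:C) * cexp ('i%C * m * t%:C) = 1.
  by rewrite -cexpD mulNr addNr cexp0.
rewrite cexpD; set A := cexp _ in H *; set B := cexp _ in H *.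
transitivity (- (A * (A * B) * s1 t * y2 t)); first by rewrite H; ring.
ring.
Qed.

Let pv2 : cprim v2 (fun t => - (q2 t * v1 t)).
Proof.
apply: cprim_ext (cprimM (cprim_cexp ('i%C * m)) py2) _ _ => // t.
rewrite /q2 /v1.
have -> : 2 * 'i%C * m * t%:C = 'i%C * m * t%:C + 'i%C * m * t%:C by ring.
have H : cexp ('i%C * m * t%:C) * cexp (- ('i%C * m) * t%:C) = 1.
  by rewrite -cexpD mulNr addrN cexp0.
rewrite cexpD; set A := cexp _ in H *; set B := cexp _ in H *.
transitivity (- (A * (A * B) * s2 t * y1 t)); first by rewrite H; ring.
ring.
Qed.

Let y1E x : 0 <= x <= 1 ->
  y1 x - cexp ('i%C * m * x%:C) - P1 x = cexp ('i%C * m * x%:C) * (v1 x - 1 - c x).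
Proof.
move=> x01; rewrite diag_kernel_integral//.
have H : cexp (- ('i%C * m) * x%:C) * cexp ('i%C * m * x%:C) = 1.
  by rewrite -cexpD mulNr addNr cexp0.
rewrite /v1; set A := cexp _ in H *; set B := cexp _ in H *.
transitivity ((A * B) * y1 x - B - B * c x); first by rewrite H; ring.
ring.
Qed.

Let y2E x : 0 <= x <= 1 ->
  y2 x - P2 x = cexp (- ('i%C * m) * x%:C) * (v2 x + b x + e x).
Proof.
move=> x01; rewrite offdiag_kernel_integral//.
have H : cexp (- ('i%C * m) * x%:C) * cexp ('i%C * m * x%:C) = 1.
  by rewrite -cexpD mulNr addNr cexp0.
rewrite /v2; set A := cexp _ in H *; set B := cexp _ in H *.
transitivity ((A * B) * y2 x - A * (- b x - e x)); first by rewrite H; ring.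
ring.
Qed.

Let in_C01N (f : R -> R[i]) : in_C01 f -> in_C01 (fun x => - f x).
Proof.
move=> cf; apply: in_C01_eq (in_C01M (cprim_cont (cprim_cst (-1))) cf) _ => x _.
by rewrite mulN1r.
Qed.

Lemma column_cont :
  in_C01 (fun x => y1 x - cexp ('i%C * m * x%:C) - P1 x) /\ in_C01 (fun x => y2 x - P2 x).
Proof.
split.
- apply: (@in_C01_eq _ (fun x => cexp ('i%C * m * x%:C) * (v1 x - 1 - c x))); last first.
    by move=> x x01; rewrite y1E.
  apply: in_C01M; first exact: in_C01_cexp.
  apply: in_C01D; last exact/in_C01N/(cprim_cont pc).
  by apply: in_C01D (cprim_cont pv1) (cprim_cont (cprim_cst (-1))).
- apply: (@in_C01_eq _ (fun x => cexp (- ('i%C * m) * x%:C) * (v2 x + b x + e x))); last first.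
    by move=> x x01; rewrite y2E.
  apply: in_C01M; first exact: in_C01_cexp.
  exact: in_C01D (in_C01D (cprim_cont pv2) (cprim_cont pb)) (cprim_cont pe).
Qed.

Lemma column_bound (G : R -> R) (g1 g : R) : rint01 G ->
  (forall t, 0 <= t <= 1 -> cmod (s1 t) * cmod (b t) ^+ 2 <= G t) ->
  \int[mu]_(t in `[0, 1]) G t = g1 -> normL 2 b <= g ->
  let B := expR (5 * d) * (normL 2 s1 ^+ 2 * g ^+ 2 / 2 + normL 1 s1 * g1) *
    expR (E * (normL 1 s1 + normL 1 s2)) in
  forall x, 0 <= x <= 1 ->
  cmod (y1 x - cexp ('i%C * m * x%:C) - P1 x) <= B /\ cmod (y2 x - P2 x) <= B.
Proof.
move=> IG sG Gg1 bg B.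
have I1 := cint01_cmod (in_L2_cint01 L1); have I2 := cint01_cmod (in_L2_cint01 L2).
pose k t := E * (cmod (s1 t) + cmod (s2 t)).
have Ik : rint01 k by apply: rint01Z; exact: rint01D.
have q1k t : 0 <= t <= 1 -> cmod (q1 t) <= k t.
  by move=> t01; rewrite (le_trans (q1_le t01))// ler_wpM2l// lerDl cmod_ge0.
have q2k t : 0 <= t <= 1 -> cmod (q2 t) <= k t.
  by move=> t01; rewrite (le_trans (q2_le t01))// ler_wpM2l// lerDr cmod_ge0.
have v10 : v1 0 = 1 by rewrite /v1 y10 mulr0 cexp0 mulr1.
have v20 : v2 0 = 0 by rewrite /v2 y20 mulr0.
have HM := forcing_bound E0 L1 Iq1 (cprim_cont pb) IG q1_le sG Gg1 bg.
have W := column_remainder Iq1 Iq2 pv1 pv2 v10 v20 Ik q1k q2k HM.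
have kE : \int[mu]_(t in `[0, 1]) k t = E * (normL 1 s1 + normL 1 s2).
  by rewrite RintegralZl//; [rewrite RintegralD// !normL1E|exact: rint01D].
rewrite kE in W.
(* One factor [exp d] from the free evolution, two factors [exp (2 d)] from the
   two coefficients in the forcing term. *)
have E5 : expR (5 * d) = expR d * E ^+ 2.
  by rewrite /E -expRM_natl -expRD; congr expR; ring.
move=> x x01; have {}W := W x x01.
split.
- rewrite y1E// cmodM /B E5.
  have U : cmod (v1 x - 1 - c x) <= cmod (v1 x - 1 - c x) + cmod (v2 x + b x + e x).
    by rewrite lerDl cmod_ge0.
  have H := ler_pM (cmod_ge0 _) (cmod_ge0 _) (cmod_cexp_im x01 md) (le_trans U W).
  by apply: (le_trans H); rewrite !mulrA.
- rewrite y2E// cmodM /B E5.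
  have U : cmod (v2 x + b x + e x) <= cmod (v1 x - 1 - c x) + cmod (v2 x + b x + e x).
    by rewrite lerDr cmod_ge0.
  have mdN : `|complex.Im (- m)| <= d by rewrite ImN normrN.
  have H := ler_pM (cmod_ge0 _) (cmod_ge0 _) (cmod_cexp_im x01 mdN) (le_trans U W).
  have -> : - ('i%C * m) * x%:C = 'i%C * (- m) * x%:C by ring.
  by apply: (le_trans H); rewrite !mulrA.
Qed.

End column.
(** * From the Cauchy problem to the four entries *)

Section entries.
Variable R : realType.
Notation mu := (@lebesgue_measure R).

(** No integrability is needed: a divergent integral is [0] on both sides. *)
Lemma RintegralN (D : set R) (f : R -> R) :
  \int[mu]_(x in D) (- f x) = - \int[mu]_(x in D) f x.
Proof.
rewrite /Rintegral.
have -> : (\int[mu]_(x in D) (- f x)%:E = \int[mu]_(x in D) (\- (EFin \o f)) x)%E by [].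
have -> : (\int[mu]_(x in D) (\- (EFin \o f)) x =
    \int[mu]_(x in D) (EFin \o f)^\- x - \int[mu]_(x in D) (EFin \o f)^\+ x)%E.
  rewrite [LHS]integralE; congr (_ - _)%E; apply: eq_integral => x _.
    exact: (congr1 (fun h => h x) (funeposN (EFin \o f))).
  exact: (congr1 (fun h => h x) (funenegN (EFin \o f))).
rewrite [in RHS]integralE.
have A0 : (0 <= \int[mu]_(x in D) (EFin \o f)^\+ x)%E.
  by apply: integral_ge0 => x _; exact: funepos_ge0.
have B0 : (0 <= \int[mu]_(x in D) (EFin \o f)^\- x)%E.
  by apply: integral_ge0 => x _; exact: funeneg_ge0.
move: A0 B0; case: (\int[mu]_(x in D) (EFin \o f)^\+ x)%E => [a| |]//;
  case: (\int[mu]_(x in D) (EFin \o f)^\- x)%E => [b| |]//= _ _; rewrite ?oppr0//.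
by rewrite opprB.
Qed.

Lemma cintegralN (a b : R) (f : R -> R[i]) :
  cintegral a b (fun t => - f t) = - cintegral a b f.
Proof.
apply: complex_eqP; rewrite /cintegral ?ReN ?ImN /= -RintegralN;
  by apply: eq_Rintegral => x _; rewrite ?ReN ?ImN.
Qed.

Lemma abs_continuous01_ReIm (y : R -> R[i]) : abs_continuous01 y ->
  rabs_continuous01 (fun t => complex.Re (y t)) /\
  rabs_continuous01 (fun t => complex.Im (y t)).
Proof.
move=> ac; split=> eps e0; have [del del0 H] := ac eps e0; exists del => // n a b ab tI abd;
  apply: le_lt_trans (H n a b ab tI abd); apply: ler_sum => i _.
- by rewrite -ReN -ReD Re_le_cmod.
- by rewrite -ImN -ImD Im_le_cmod.
Qed.

Lemma cprim_of_ac (y g : R -> R[i]) : abs_continuous01 y ->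
  (in_C01 y -> cint01 g) ->
  {ae mu, forall x : R, 0 <= x <= 1 ->
     [/\ derivable (fun t => complex.Re (y t)) x 1, derivable (fun t => complex.Im (y t)) x 1,
        derive1 (fun t => complex.Re (y t)) x = complex.Re (g x) &
        derive1 (fun t => complex.Im (y t)) x = complex.Im (g x)]} ->
  cprim y g.
Proof.
move=> ac Ig ae.
have F : Filter (almost_everywhere mu) by exact: (ae_filter_ringOfSetsType mu).
have [acR acI] := abs_continuous01_ReIm ac.
have [IR II] := Ig (conj (rabs_continuous_cont acR) (rabs_continuous_cont acI)).
split.
- apply: rprimP => //; apply: (@filterS _ _ F _ _ _ ae) => x Hx /andP[x0 x1].
  by have [|] := Hx _; rewrite ?(ltW x0) ?(ltW x1).
- apply: rprimP => //; apply: (@filterS _ _ F _ _ _ ae) => x Hx /andP[x0 x1].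
  by have [|] := Hx _; rewrite ?(ltW x0) ?(ltW x1).
Qed.

(** The matrix Cauchy problem, column by column and in integrated form. *)
Lemma cauchy_system (s1 s2 : R -> R[i]) (m : R[i]) (D : R -> 'M[R[i]]_2) (j : 'I_2) :
  cint01 s1 -> cint01 s2 -> is_cauchy_solution s1 s2 m D ->
  cprim (fun t => D t 0 j) (fun t => 'i%C * m * D t 0 j - s1 t * D t 1 j) /\
  cprim (fun t => D t 1 j) (fun t => - ('i%C * m) * D t 1 j - s2 t * D t 0 j).
Proof.
move=> I1 I2 [ac ode _].
have ycont k : in_C01 (fun t => D t k j).
  by have [/rabs_continuous_cont cR /rabs_continuous_cont cI] := abs_continuous01_ReIm (ac k j).
have F : Filter (almost_everywhere mu) by exact: (ae_filter_ringOfSetsType mu).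
have Ig (z : R[i]) (s y1 y2 : R -> R[i]) : cint01 s -> in_C01 y1 -> in_C01 y2 ->
    cint01 (fun t => z * y1 t - s t * y2 t).
  move=> Is c1 c2; apply: cint01D; last by apply: cint01N; exact: cint01Mr.
  apply: cint01M; first exact: cprim_cont (cprim_cst z).
  by case: c1 => cR cI; split; exact: rint01_cont.
have E (x : R) : mxderive D x + Jmx s1 s2 x *m D x = Amx m *m D x ->
   mxderive D x 0 j = 'i%C * m * D x 0 j - s1 x * D x 1 j /\
   mxderive D x 1 j = - ('i%C * m) * D x 1 j - s2 x * D x 0 j.
  move=> H; have H0 := congr1 (fun M : 'M[R[i]]_2 => M 0 j) H.
  have H1 := congr1 (fun M : 'M[R[i]]_2 => M 1 j) H.
  move: H0 H1; rewrite ![((_ + _)%R : 'M[R[i]]_2) _ _]mxE !mul22E ![Amx _ _ _]mxE !mx22E.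
  by move=> /(canRL (addrK _)) -> /(canRL (addrK _)) ->; split; ring.
split; apply: cprim_of_ac => //; do ?[by move=> _; exact: Ig];
  apply: (@filterS _ _ F _ _ _ ode) => x Hx x01; have [dD /E[E1 E2]] := Hx x01.
- have [dR dI] := dD 0 j; move: E1; rewrite [mxderive _ _ _ _]mxE => E1; split => //.
  + by rewrite -E1.
  + by rewrite -E1.
- have [dR dI] := dD 1 j; move: E2; rewrite [mxderive _ _ _ _]mxE => E2; split => //.
  + by rewrite -E2.
  + by rewrite -E2.
Qed.

Lemma cintegral0 (a b : R) : cintegral a b (fun=> 0) = 0.
Proof. by rewrite /cintegral /= /Rintegral !integral0. Qed.

(** The entries of [D0mx]; the second column is the first one with the two
    coefficients exchanged and [m] replaced by [- m]. *)
Lemma D0mxE (s1 s2 : R -> R[i]) (x : R) (m : R[i]) :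
  let P (s s' : R -> R[i]) (m' : R[i]) :=
    cintegral 0 x (fun t => cexp ('i%C * m' * (x - 2 * t)%:C) * tsigma s s' x t) in
  let Q (s s' : R -> R[i]) (m' : R[i]) :=
    - cintegral 0 x (fun t => cexp (- ('i%C * m') * (x - 2 * t)%:C) * s' t)
    - cintegral 0 x (fun t => cexp (- ('i%C * m') * (x - 2 * t)%:C) * Top s' (tsigma s s') x t) in
  [/\ D0mx s1 s2 x m 0 0 = P s1 s2 m, D0mx s1 s2 x m 1 0 = Q s1 s2 m,
      D0mx s1 s2 x m 1 1 = P s2 s1 (- m) & D0mx s1 s2 x m 0 1 = Q s2 s1 (- m)].
Proof.
move=> P Q.
have DE k j : D0mx s1 s2 x m k j =
    - cintegral 0 x (fun t => (expmx ((x - 2 * t)%:C *: Amx m) *m Jmx s1 s2 t) k j)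
    + cintegral 0 x (fun t => (expmx ((x - 2 * t)%:C *: Amx m) *m Nmx s1 s2 x t) k j).
  have mxD (A B : 'M[R[i]]_2) : (- A + B) k j = - A k j + B k j by rewrite !mxE.
  have mxI F : mxintegral 0 x F k j = cintegral 0 x (fun t => F t k j) by rewrite mxE.
  by rewrite /D0mx mxD; congr (- _ + _); exact: mxI.
have mN (t : R) : 'i%C * (- m) * (x - 2 * t)%:C = - ('i%C * m) * (x - 2 * t)%:C by ring.
have mNN (t : R) : - ('i%C * - m) * (x - 2 * t)%:C = 'i%C * m * (x - 2 * t)%:C by ring.
split; rewrite DE /P /Q.
- rewrite [X in - X + _](_ : _ = 0) ?oppr0 ?add0r; last first.
    rewrite -[RHS](cintegral0 0 x); apply: eq_cintegral => t _.
    by rewrite mul22E expmx_Amx !mx22E mulr0 mul0r addr0.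
  by apply: eq_cintegral => t _; rewrite mul22E expmx_Amx !mx22E mul0r addr0.
- congr (- _ + _).
    by apply: eq_cintegral => t _; rewrite mul22E expmx_Amx !mx22E mul0r add0r.
  rewrite -cintegralN; apply: eq_cintegral => t _.
  by rewrite mul22E expmx_Amx !mx22E mul0r add0r mulrN.
- rewrite [X in - X + _](_ : _ = 0) ?oppr0 ?add0r; last first.
    rewrite -[RHS](cintegral0 0 x); apply: eq_cintegral => t _.
    by rewrite mul22E expmx_Amx !mx22E mulr0 mul0r addr0.
  by apply: eq_cintegral => t _; rewrite mul22E expmx_Amx !mx22E mul0r add0r mN.
- congr (- _ + _).
    by apply: eq_cintegral => t _; rewrite mul22E expmx_Amx !mx22E mul0r addr0 mNN.
  rewrite -cintegralN; apply: eq_cintegral => t _.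
  by rewrite mul22E expmx_Amx !mx22E mul0r addr0 mulrN mNN.
Qed.

Lemma in_C01_osc (s : R -> R[i]) (m : R[i]) : cint01 s ->
  in_C01 (osc_minus s m) /\ in_C01 (osc_plus s m).
Proof.
move=> Is; split; apply: cprim_cont; apply: cprim_cintegral;
  by apply: cint01M => //; exact: cprim_cont (cprim_cexp _).
Qed.

Lemma osc_plusN (s : R -> R[i]) (m : R[i]) x : osc_plus s (- m) x = osc_minus s m x.
Proof.
apply: eq_cintegral => t _; congr (cexp _ * _); ring.
Qed.

Section gammas.
Variables (s1 s2 : R -> R[i]) (m : R[i]).
Hypotheses (I1 : cint01 s1) (I2 : cint01 s2).

Let G (t : R) := sigma0 s1 s2 t * gamma0 s1 s2 t m ^+ 2.

Lemma gamma0E t : gamma0 s1 s2 t m = cmod (osc_minus s1 m t) + cmod (osc_plus s1 m t) +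
  (cmod (osc_minus s2 m t) + cmod (osc_plus s2 m t)).
Proof. by rewrite /gamma0 !big_cons big_nil addr0. Qed.

Lemma gammaE : gamma s1 s2 m = normL 2 (osc_minus s1 m) + normL 2 (osc_plus s1 m) +
  (normL 2 (osc_minus s2 m) + normL 2 (osc_plus s2 m)).
Proof. by rewrite /gamma !big_cons big_nil addr0. Qed.

Lemma rint01_gamma1 : rint01 G.
Proof.
apply: rint01Mr; first by apply: rint01D; exact: cint01_cmod.
have [m1 p1] := in_C01_osc m I1; have [m2 p2] := in_C01_osc m I2.
have cg : {within `[0, 1], continuous (fun t => gamma0 s1 s2 t m)}.
  have -> : (fun t => gamma0 s1 s2 t m) = (fun t => cmod (osc_minus s1 m t) +
      cmod (osc_plus s1 m t) + (cmod (osc_minus s2 m t) + cmod (osc_plus s2 m t))).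
    by apply/funext => t; exact: gamma0E.
  exact: (within_contD (within_contD (cmod_cont m1) (cmod_cont p1))
                       (within_contD (cmod_cont m2) (cmod_cont p2))).
have -> : (fun t => gamma0 s1 s2 t m ^+ 2) = (fun t => gamma0 s1 s2 t m * gamma0 s1 s2 t m).
  by apply/funext => t; rewrite expr2.
exact: (within_contM cg cg).
Qed.

Lemma gamma1_dom (s : R -> R[i]) (z : R -> R[i]) t :
  cmod (s t) <= sigma0 s1 s2 t -> cmod (z t) <= gamma0 s1 s2 t m ->
  cmod (s t) * cmod (z t) ^+ 2 <= G t.
Proof.
move=> ss zg; rewrite ler_pM ?cmod_ge0 ?sqr_ge0// ler_pXn2r ?nnegrE ?cmod_ge0//.
by apply: le_trans zg; exact: cmod_ge0.
Qed.

Lemma osc_le_gamma0 t : [/\ cmod (osc_minus s1 m t) <= gamma0 s1 s2 t m,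
  cmod (osc_plus s1 m t) <= gamma0 s1 s2 t m, cmod (osc_minus s2 m t) <= gamma0 s1 s2 t m &
  cmod (osc_plus s2 m t) <= gamma0 s1 s2 t m].
Proof.
rewrite gamma0E; have := cmod_ge0 (osc_minus s1 m t); have := cmod_ge0 (osc_plus s1 m t).
have := cmod_ge0 (osc_minus s2 m t); have := cmod_ge0 (osc_plus s2 m t).
set x1 := cmod _; set x2 := cmod _; set x3 := cmod _; set x4 := cmod _ => h1 h2 h3 h4.
by split; lra.
Qed.

Lemma normL_osc_le_gamma : normL 2 (osc_minus s1 m) <= gamma s1 s2 m /\
  normL 2 (osc_plus s2 m) <= gamma s1 s2 m.
Proof.
rewrite gammaE; have := normL_ge0 2 (osc_minus s1 m); have := normL_ge0 2 (osc_plus s1 m).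
have := normL_ge0 2 (osc_minus s2 m); have := normL_ge0 2 (osc_plus s2 m).
set x1 := normL _ _; set x2 := normL _ _; set x3 := normL _ _; set x4 := normL _ _ => h1 h2 h3 h4.
by split; lra.
Qed.

End gammas.
End entries.

Theorem lemma2p4 (R : realType) (sigma1 sigma2 : R -> R[i]) (d : R)
    (hsigma1 : in_Lp01 2 sigma1) (hsigma2 : in_Lp01 2 sigma2) (hd : 0 < d)
    (D : R -> R[i] -> 'M[R[i]]_2)
    (hD : forall mu : R[i],
      is_cauchy_solution sigma1 sigma2 mu (fun x => D x mu)) :
  exists D1 : R -> R[i] -> 'M[R[i]]_2,
    (forall (x : R) (mu : R[i]), 0 <= x <= 1 ->
       D x mu = expmx (x%:C *: Amx mu) + D0mx sigma1 sigma2 x mu + D1 x mu) /\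
    (forall mu : R[i], strip d mu ->
       in_M (@in_C01 R) (fun x => D1 x mu) /\
       (normM (@normC01 R) (fun x => D1 x mu)
        <= (2 * expR (5 * d) * expR (expR (2 * d) * l1 sigma1 sigma2)
            * gamma2 sigma1 sigma2 mu)%:E)%E).
Proof.
exists (fun x m => D x m - (expmx (x%:C *: Amx m) + D0mx sigma1 sigma2 x m)).
split=> [x m _|m md]; first by rewrite addrC subrK.
have I1 := in_L2_cint01 hsigma1; have I2 := in_L2_cint01 hsigma2.
have mdN : `|complex.Im (- m)| <= d by rewrite ImN normrN.
have o2 (k : 'I_2) : k = 0 \/ k = 1.
  by case: k => [[|[|//]]] k2; [left|right]; exact/val_inj.
have [p00 p10] := cauchy_system 0 I1 I2 (hD m).
have [p01 p11] := cauchy_system 1 I1 I2 (hD m).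
have D0E : D 0 m = 1%:M by case: (hD m).
(* The second column is a first column for the swapped coefficients and [- m]. *)
have p11' : cprim (fun t => D t m 1 1)
    (fun t => 'i%C * (- m) * D t m 1 1 - sigma2 t * D t m 0 1).
  by apply: cprim_ext p11 _ _ => // t; ring.
have p01' : cprim (fun t => D t m 0 1)
    (fun t => - ('i%C * (- m)) * D t m 0 1 - sigma1 t * D t m 1 1).
  by apply: cprim_ext p01 _ _ => // t; ring.
have d00 : D 0 m 0 0 = 1 by rewrite D0E mxE.
have d10 : D 0 m 1 0 = 0 by rewrite D0E mxE.
have d11 : D 0 m 1 1 = 1 by rewrite D0E mxE.
have d01 : D 0 m 0 1 = 0 by rewrite D0E mxE.
have [c00 c10] := column_cont hsigma1 hsigma2 p00 p10.
have [c11 c01] := column_cont hsigma2 hsigma1 p11' p01'.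
pose g := gamma sigma1 sigma2 m; pose g1 := gamma1 sigma1 sigma2 m.
have IG := rint01_gamma1 m I1 I2.
have [gm gp] := normL_osc_le_gamma sigma1 sigma2 m.
have s1le t : cmod (sigma1 t) <= sigma0 sigma1 sigma2 t by rewrite lerDl cmod_ge0.
have s2le t : cmod (sigma2 t) <= sigma0 sigma1 sigma2 t by rewrite lerDr cmod_ge0.
have bE : cintegral 0 ^~ (fun t => cexp (2 * 'i%C * (- m) * t%:C) * sigma1 t) = osc_minus sigma1 m.
  by apply/funext => x; exact: osc_plusN.
have dom1 t : 0 <= t <= 1 -> cmod (sigma1 t) * cmod (osc_plus sigma2 m t) ^+ 2 <=
    sigma0 sigma1 sigma2 t * gamma0 sigma1 sigma2 t m ^+ 2.
  by move=> _; apply: gamma1_dom => //; have [] := osc_le_gamma0 sigma1 sigma2 m t.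
have dom2 t : 0 <= t <= 1 -> cmod (sigma2 t) * cmod (osc_minus sigma1 m t) ^+ 2 <=
    sigma0 sigma1 sigma2 t * gamma0 sigma1 sigma2 t m ^+ 2.
  by move=> _; apply: gamma1_dom => //; have [] := osc_le_gamma0 sigma1 sigma2 m t.
have B1 := column_bound hsigma1 hsigma2 md p00 p10 d00 d10 IG (g1 := g1) (g := g)
  dom1 erefl gp.
have B2 : forall x, 0 <= x <= 1 -> _ := column_bound hsigma2 hsigma1 mdN p11' p01' d11 d01 IG
  (g1 := g1) (g := g) ltac:(by rewrite bE) erefl ltac:(by rewrite bE).
move: B1 B2.
set K1 := expR (5 * d) * _ * _; set K2 := expR (5 * d) * _ * _ => B1 B2.
pose D1 x := D x m - (expmx (x%:C *: Amx m) + D0mx sigma1 sigma2 x m).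
rewrite -/(D1 _).
have mxD (A B C : 'M[R[i]]_2) k j : (A - (B + C)) k j = A k j - B k j - C k j.
  by rewrite !mxE opprD addrA.
have D1E x k j : D1 x k j = D x m k j - expmx (x%:C *: Amx m) k j - D0mx sigma1 sigma2 x m k j.
  exact: mxD.
have mN (x : R) : 'i%C * (- m) * x%:C = - ('i%C * m) * x%:C by ring.
have entry k j : in_C01 (fun x => D1 x k j) /\
    forall x, 0 <= x <= 1 -> cmod (D1 x k j) <= if j == 0 then K1 else K2.
  case: (o2 k) => ->; case: (o2 j) => ->.
  - split=> [|x x01]; first apply: in_C01_eq c00 _ => x x01;
      by have [E _ _ _] := D0mxE sigma1 sigma2 x m; rewrite D1E E expmx_Amx mx22E//; have [] := B1 x x01.
  - split=> [|x x01]; first apply: in_C01_eq c01 _ => x x01;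
      by have [_ _ _ E] := D0mxE sigma1 sigma2 x m; rewrite D1E E expmx_Amx mx22E subr0//; have [] := B2 x x01.
  - split=> [|x x01]; first apply: in_C01_eq c10 _ => x x01;
      by have [_ E _ _] := D0mxE sigma1 sigma2 x m; rewrite D1E E expmx_Amx mx22E subr0//; have [] := B1 x x01.
  - split=> [|x x01]; first apply: in_C01_eq c11 _ => x x01;
      by have [_ _ E _] := D0mxE sigma1 sigma2 x m; rewrite D1E E expmx_Amx mx22E -mN//; have [] := B2 x x01.
split; first by move=> k j; have [] := entry k j.
(* The estimate leaves a factor 2 to spare on the term in [gamma ^+ 2]. *)
have KE : 2 * (K1 + K2) <= 2 * expR (5 * d) * expR (expR (2 * d) * l1 sigma1 sigma2)
    * gamma2 sigma1 sigma2 m.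
  rewrite /K1 /K2 /gamma2 /l1 /l2 -/g -/g1 [normL 1 sigma2 + _]addrC.
  set X := expR (5 * d); set Y := expR (_ * _).
  have X0 : 0 <= X by exact: expR_ge0.
  have Y0 : 0 <= Y by exact: expR_ge0.
  set n1 := normL 2 sigma1; set n2 := normL 2 sigma2.
  have H : 0 <= 2 * X * Y * ((n1 ^+ 2 + n2 ^+ 2) * g ^+ 2 / 2).
    apply: mulr_ge0; first by rewrite !mulr_ge0.
    apply: mulr_ge0; last by rewrite invr_ge0.
    by rewrite mulr_ge0 ?addr_ge0 ?sqr_ge0.
  rewrite -subr_ge0; apply: le_trans H _; rewrite le_eqVlt; apply/orP; left; apply/eqP.
  by field.
(* Each column has two entries, both bounded by the same constant. *)
apply: (@le_trans _ _ (2 * (K1 + K2))%:E); last by rewrite lee_fin.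
have -> : ((2 * (K1 + K2))%:E = \sum_(k < 2) \sum_(j < 2) (if j == 0 then K1 else K2)%:E)%E.
  by rewrite !big_ord_recl !big_ord0 /= -!EFinD; congr EFin; ring.
apply: lee_sum => k _; apply: lee_sum => j _.
apply: ge_ereal_sup => _ [x /=] /[!in_itv]/= x01 <-.
by rewrite lee_fin; have [_] := entry k j; apply.
Qed.
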